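(* Let $G$ be a locally compact second countable group with a Borel 2-cocycle $\omega\colon G\times G\to\mathbb{T}$. For an $\omega$-projective representation $(\pi,\mathcal{H})$ of $G$ let $(\pi_\omega,\mathcal{H})$ be the representation of $\mathbb{T}\rtimes_{(1,\omega)}G$ given by $\pi_\omega(a,s):=a\pi(s)$. Then: (a) $(\pi,\mathcal{H})$ is a factorial square integrable $\omega$-projective representation of $G$ if and only if $(\pi_\omega,\mathcal{H})$ is a factorial square integrable representation of $\mathbb{T}\rtimes_{(1,\omega)}G$. Furthermore, the semi-invariant weight of degree $\Delta_G$ on $\pi(G)''$ is also a semi-invariant weight of degree $\Delta_{\mathbb{T}\rtimes_{(1,\omega)}G}$ on $\pi_\omega(\mathbb{T}\rtimes_{(1,\omega)}G)''$. (b) $(\pi,\mathcal{H})$ is quasi-equivalent to $(\rho,\mathcal{K})$ as $\omega$-projective representations of $G$ if and only if $(\pi_\omega,\mathcal{H})$ is quasi-equivalent to $(\rho_\omega,\mathcal{K})$ as representations of $\mathbb{T}\rtimes_{(1,\omega)}G$.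
   Context: $\Delta_\Gamma$ denotes the modular function of a locally compact group $\Gamma$, normalized by $\mu_\Gamma(Es)=\Delta_\Gamma(s)\mu_\Gamma(E)$ for a left Haar measure $\mu_\Gamma$. A Borel 2-cocycle is a Borel map $\omega\colon G\times G\to\mathbb{T}$ with $\omega(s,t)\omega(st,r)=\omega(t,r)\omega(s,tr)$. $\mathbb{T}\rtimes_{(1,\omega)}G$ is the set $\mathbb{T}\times G$ with multiplication $(a,s)(b,t)=(ab\,\omega(s,t),st)$ and the unique locally compact second countable group topology whose Borel structure is the product Borel structure; $\mu_{\mathbb{T}}\times\mu_G$ is a left Haar measure and its modular function is $(a,s)\mapsto\Delta_G(s)$. An $\omega$-projective representation $(\pi,\mathcal{H})$ of $G$ is a map $\pi\colon G\to U(\mathcal{H})$ with $\pi(s)\pi(t)=\omega(s,t)\pi(st)$ such that $s\mapsto\langle\pi(s)\xi,\eta\rangle$ is Borel measurable for all $\xi,\eta$. It is factorial if $\pi(G)''$ is a factor; a factorial one is square integrable if there are $\xi,\eta\in\mathcal{H}$ such that $s\mapsto\langle\pi(s)\xi,\eta\rangle$ is a non-zero element of $L^2(G)$. Two $\omega$-projective representations $(\pi_1,\mathcal{H}_1),(\pi_2,\mathcal{H}_2)$ are quasi-equivalent if there is an isomorphism $\Phi\colon\pi_1(G)''\to\pi_2(G)''$ of von Neumann algebras with $\Phi(\pi_1(s))=\pi_2(s)$ for all $s$. The same definitions with trivial cocycle apply to ordinary (strongly continuous unitary) representations. For a factorial $\omega$-projective representation $(\pi,\mathcal{H})$ and a continuous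 homomorphism $\Delta\colon G\to\mathbb{R}_+$, a non-zero normal semifinite weight $\psi$ on $\pi(G)''$ is semi-invariant of degree $\Delta$ if $\psi(\pi(s)x\pi(s)^* )=\Delta(s)\psi(x)$ for $s\in G$, $x\in(\pi(G)'')_+$. When $(\pi,\mathcal{H})$ is factorial and square integrable, a semi-invariant weight of degree $\Delta_G$ exists and is faithful and unique up to scaling. *)

(* Defs.v *)
From HB Require Import structures.
From mathcomp Require Import all_boot all_order all_algebra.
From mathcomp Require Import sesquilinear complex.
From mathcomp Require Import all_classical all_reals all_analysis.
From mathcomp Require Import ring.
Import Order.TTheory GRing.Theory Num.Theory.
Import numFieldNormedType.Exports.

Set Implicit Arguments.
Unset Strict Implicit.
Unset Printing Implicit Defensive.

Local Open Scope classical_set_scope.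
Local Open Scope complex_scope.
Local Open Scope ring_scope.

(* Naming the numClosedFieldType R[i] lets inference find its norm topology. *)
Definition cplx (R : realType) : numClosedFieldType := R[i].

(* The distinguished point is only there because g_sigma_algebraType and
   measure theory ask for pointed types; it carries no information. *)
#[short(type="preTopGroupType")]
HB.structure Definition PreTopGroup :=
  {G of Group G & PointedTopological G}.

Definition lcsc_group (G : preTopGroupType) : Prop :=
  [/\ continuous (fun p : G * G => p.1 * p.2)%g,
      continuous (fun x : G => x^-1)%g,
      hausdorff_space G,
      locally_compact [set: G] &
      @second_countable G].

Notation borelType T := (g_sigma_algebraType (@open T)).

(* On a locally compact second countable group every Borel measure that is
   finite on compact sets is regular, so regularity is not listed. *)
Definition left_haar (R : realType) (G : preTopGroupType)
    (mu : {measure set (borelType G) -> \bar R}) : Prop :=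
  [/\ mu setT <> 0%E,
      forall K : set G, compact K -> (mu K < +oo)%E &
      forall (s : G) (E : set G), measurable (E : set (borelType G)) ->
        mu [set (s * x)%g | x in E] = mu E].

Definition modular_function (R : realType) (G : preTopGroupType)
    (mu : {measure set (borelType G) -> \bar R}) (Delta : G -> R) : Prop :=
  (forall s, 0 < Delta s) /\
  (forall (s : G) (E : set G), measurable (E : set (borelType G)) ->
     mu [set (x * s)%g | x in E] = ((Delta s)%:E * mu E)%E).

Section Circle.
Variable R : realType.

Definition circle : Type := {z : cplx R | `|z| == 1}.

HB.instance Definition _ := Choice.copy circle {z : cplx R | `|z| == 1}.

Definition circle_val (a : circle) : cplx R := sval a.

Definition circle1 : circle := exist _ 1 (introT eqP (normr1 _)).

Lemma circle_mul_subproof (a b : circle) : `|sval a * sval b| == 1.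
Proof. by rewrite normrM (eqP (svalP a)) (eqP (svalP b)) mulr1. Qed.

Definition circle_mul (a b : circle) : circle :=
  exist _ (sval a * sval b) (circle_mul_subproof a b).

Lemma circle_inv_subproof (a : circle) : `|(sval a)^-1| == 1.
Proof. by rewrite normfV (eqP (svalP a)) invr1. Qed.

Definition circle_inv (a : circle) : circle :=
  exist _ (sval a)^-1 (circle_inv_subproof a).

HB.instance Definition _ := isPointed.Build circle circle1.
HB.instance Definition _ :=
  Topological.copy circle (initial_topology circle_val).

Lemma circle_valI : injective circle_val.
Proof. by move=> a b ab; apply: val_inj. Qed.

Lemma circle_val_neq0 a : circle_val a != 0.
Proof. by rewrite -normr_eq0 (eqP (svalP a)) oner_eq0. Qed.

Lemma circle_mulA : associative circle_mul.
Proof. by move=> a b c; apply: circle_valI; rewrite /circle_val /= mulrA. Qed.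

Lemma circle_mulC : commutative circle_mul.
Proof. by move=> a b; apply: circle_valI; rewrite /circle_val /= mulrC. Qed.

Lemma circle_mul1 : left_id circle1 circle_mul.
Proof. by move=> a; apply: circle_valI; rewrite /circle_val /= mul1r. Qed.

Lemma circle_mulV : left_inverse circle1 circle_inv circle_mul.
Proof.
move=> a; apply: circle_valI; rewrite /circle_val /= mulVf//.
exact: circle_val_neq0.
Qed.

Lemma circle_mul1r : right_id circle1 circle_mul.
Proof. by move=> a; rewrite circle_mulC circle_mul1. Qed.

Lemma circle_mulVr : right_inverse circle1 circle_inv circle_mul.
Proof. by move=> a; rewrite circle_mulC circle_mulV. Qed.

HB.instance Definition _ := isGroup.Build circle
  circle_mulA circle_mul1 circle_mul1r circle_mulV circle_mulVr.

Lemma circle_valM (a b : circle) :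
  circle_val (a * b)%g = circle_val a * circle_val b.
Proof. by []. Qed.

Lemma circle_valV (a : circle) : circle_val a^-1%g = (circle_val a)^-1.
Proof. by []. Qed.

End Circle.

Record borel_cocycle (R : realType) (G : preTopGroupType) := BorelCocycle {
  cocycle_fun :> G -> G -> circle R;
  cocycle_measurable : measurable_fun [set: borelType (G * G)%type]
    ((fun p => cocycle_fun p.1 p.2) :
       borelType (G * G)%type -> borelType (circle R));
  cocycleP : forall s t r : G,
    (cocycle_fun s t * cocycle_fun (s * t) r =
     cocycle_fun t r * cocycle_fun s (t * r))%g
}.

Record topology_on (T : Type) := TopologyOn {
  topo_open : set_system T;
  topo_openT : topo_open setT;
  topo_openI : setI_closed topo_open;
  topo_open_bigU : forall (I : Type) (f : I -> set T),
    (forall i, topo_open (f i)) -> topo_open (\bigcup_i f i)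
}.

Section TwistedProduct.
Variables (R : realType) (G : preTopGroupType) (omega : borel_cocycle R G).

Lemma cocycle1l (s : G) : omega 1%g s = omega 1%g 1%g.
Proof.
have := cocycleP omega 1%g 1%g s.
by rewrite !mul1g => /mulIg ->.
Qed.

Lemma cocycle1r (s : G) : omega s 1%g = omega 1%g 1%g.
Proof.
have := cocycleP omega s 1%g 1%g.
by rewrite !mulg1 => /mulIg.
Qed.

Lemma cocycleV (s : G) : omega s s^-1%g = omega s^-1%g s.
Proof.
have := cocycleP omega s s^-1%g s.
rewrite mulgV mulVg cocycle1l cocycle1r => e.
by apply: (mulIg (omega 1 1)%g); rewrite e.
Qed.

(* The group T x|_(1, omega) G, carrying the topology tau. *)
Definition twisted (om : borel_cocycle R G)
  (tau : topology_on (circle R * G)) : Type := (circle R * G)%type.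

Variable tau : topology_on (circle R * G).
Local Notation Gamma := (twisted omega tau).

(* As omega is not assumed normalized, the unit need not be (1, 1). *)
Definition tw_one : Gamma := ((omega 1 1)^-1, 1)%g.
Definition tw_mul (x y : Gamma) : Gamma :=
  (x.1 * y.1 * omega x.2 y.2, x.2 * y.2)%g.
Definition tw_inv (x : Gamma) : Gamma :=
  (x.1^-1 * (omega x.2^-1 x.2)^-1 * (omega 1 1)^-1, x.2^-1)%g.

Lemma tw_mulA : associative tw_mul.
Proof.
move=> x y z; rewrite /tw_mul /= !mulgA; congr pair.
have /(congr1 (@circle_val R)) := cocycleP omega x.2 y.2 z.2.
rewrite !circle_valM => e; apply: circle_valI; rewrite !circle_valM.
by ring: e.
Qed.

Lemma tw_mul1g : left_id tw_one tw_mul.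
Proof.
move=> [a s]; rewrite /tw_mul /= mul1g cocycle1l; congr pair.
apply: circle_valI; rewrite !circle_valM circle_valV.
by field; exact: circle_val_neq0.
Qed.

Lemma tw_mulg1 : right_id tw_one tw_mul.
Proof.
move=> [a s]; rewrite /tw_mul /= mulg1 cocycle1r; congr pair.
by rewrite -mulgA mulVg mulg1.
Qed.

Lemma tw_mulVg : left_inverse tw_one tw_inv tw_mul.
Proof.
move=> [a s]; rewrite /tw_mul /tw_one /= mulVg; congr pair.
apply: circle_valI; rewrite !(circle_valM, circle_valV).
by field; rewrite !circle_val_neq0.
Qed.

Lemma tw_mulgV : right_inverse tw_one tw_inv tw_mul.
Proof.
move=> [a s]; rewrite /tw_mul /tw_one /= mulgV cocycleV; congr pair.
apply: circle_valI; rewrite !(circle_valM, circle_valV).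
by field; rewrite !circle_val_neq0.
Qed.

HB.instance Definition _ := Choice.copy Gamma (circle R * G)%type.
HB.instance Definition _ := isPointed.Build Gamma tw_one.
HB.instance Definition _ :=
  isGroup.Build Gamma tw_mulA tw_mul1g tw_mulg1 tw_mulVg tw_mulgV.
HB.instance Definition _ := isOpenTopological.Build Gamma
  (topo_openT tau) (@topo_openI _ tau) (@topo_open_bigU _ tau).

(* tau makes T x|_(1, omega) G a locally compact second countable group and
   its Borel sets are those of the product Borel structure. *)
Definition twisted_topology : Prop :=
  lcsc_group Gamma /\
  (measurable : set (set (borelType Gamma))) =
  (measurable : set (set (borelType (circle R) * borelType G)%type)).

End TwistedProduct.

Record hilbert (R : realType) := Hilbert {
  hilbert_sort :> completeNormedModType (cplx R);
  hdot : {dot hilbert_sort for Num.conj};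
  hdot_norm : forall x : hilbert_sort, `|x| ^+ 2 = hdot x x
}.

Section Operators.
Variables (R : realType) (H : hilbert R).
Local Notation "''[' x , y ]" := (hdot H x y) : ring_scope.
Implicit Types (T U : H -> H) (S M : set (H -> H)).

Definition hseparable : Prop :=
  exists2 D : set H, countable D & dense D.

Definition bounded_operator : set (H -> H) :=
  [set T | linear T /\ continuous T].

Definition unitary : set (H -> H) :=
  [set T | [/\ linear T, forall x y, '[T x, T y] = '[x, y] &
               forall y, exists x, T x = y]].

Definition is_adjoint T T' : Prop := forall x y, '[T x, y] = '[x, T' y].

(* For bounded T the adjoint exists and is unique by the Riesz theorem. *)
Definition adjoint T : H -> H := xget (fun=> 0) (is_adjoint T).

Definition commutant S : set (H -> H) :=
  bounded_operator `&` [set T : H -> H | forall U, S U -> T \o U = U \o T].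

Definition is_factor M : Prop :=
  M `&` commutant M = [set T | exists c : cplx R, T = fun x => c *: x].

Definition positive_part M : set (H -> H) :=
  M `&` [set T | forall x, 0 <= '[T x, x]].

Definition op_le T U : Prop := forall x, '[T x, x] <= '[U x, x].

Definition op_span S : set (H -> H) :=
  [set T | exists n (c : 'I_n -> cplx R) (U : 'I_n -> H -> H),
     (forall i, S (U i)) /\ T = fun x => \sum_(i < n) c i *: U i x].

Definition square_summable (xi : nat -> H) : Prop :=
  cvgn (series (fun k => `|xi k| ^+ 2 : cplx R)).

Definition ultraweak_form (xi eta : nat -> H) T : cplx R :=
  limn (series (fun k => '[T (xi k), eta k])).

(* S is dense in M for the sigma-weak topology. *)
Definition sigma_weakly_dense S M : Prop :=
  forall T, M T ->
  forall n (xi eta : 'I_n -> nat -> H),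
    (forall i, square_summable (xi i) /\ square_summable (eta i)) ->
  forall e : R, 0 < e -> exists2 U, S U &
    forall i, `|ultraweak_form (xi i) (eta i) (fun x => T x - U x)| < e%:C.

Definition weight M (psi : (H -> H) -> \bar R) : Prop :=
  [/\ forall T, positive_part M T -> (0 <= psi T)%E,
      forall T U, positive_part M T -> positive_part M U ->
        psi (fun x => T x + U x) = (psi T + psi U)%E &
      forall (c : R) T, 0 <= c -> positive_part M T ->
        psi (fun x => (c%:C : cplx R) *: T x) = (c%:E * psi T)%E].

(* Bounded increasing nets are represented by their (upward directed) ranges;
   T is the supremum of D in M_+. *)
Definition normal_weight M (psi : (H -> H) -> \bar R) : Prop :=
  forall (D : set (H -> H)) T, D !=set0 -> D `<=` positive_part M ->
    (forall U V, D U -> D V -> exists W, [/\ D W, op_le U W & op_le V W]) ->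
    positive_part M T -> (forall U, D U -> op_le U T) ->
    (forall V, positive_part M V -> (forall U, D U -> op_le U V) ->
       op_le T V) ->
  psi T = ereal_sup [set psi U | U in D].

Definition semifinite_weight M (psi : (H -> H) -> \bar R) : Prop :=
  sigma_weakly_dense
    (op_span (positive_part M `&` [set T | (psi T < +oo)%E])) M.

Definition nonzero_weight M (psi : (H -> H) -> \bar R) : Prop :=
  exists2 T, positive_part M T & psi T <> 0%E.

Definition vN_generated (I : Type) (pi : I -> H -> H) : set (H -> H) :=
  commutant (commutant (range pi)).

Definition semi_invariant_weight (I : Type) (pi : I -> H -> H)
    (Delta : I -> R) (psi : (H -> H) -> \bar R) : Prop :=
  [/\ weight (vN_generated pi) psi, nonzero_weight (vN_generated pi) psi,
      normal_weight (vN_generated pi) psi,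
      semifinite_weight (vN_generated pi) psi &
      forall s T, positive_part (vN_generated pi) T ->
        psi (pi s \o T \o adjoint (pi s)) = ((Delta s)%:E * psi T)%E].

Section Representations.
Variable G : preTopGroupType.

Definition projective_rep (omega : G -> G -> circle R) (pi : G -> H -> H) :
    Prop :=
  [/\ forall s, unitary (pi s),
      forall s t, pi s \o pi t =
        fun x => circle_val (omega s t) *: pi (s * t)%g x &
      forall xi eta, measurable_fun [set: borelType G]
        ((fun s => '[pi s xi, eta]) : borelType G -> borelType (cplx R))].

Definition unitary_rep (pi : G -> H -> H) : Prop :=
  [/\ forall s, unitary (pi s),
      forall s t, pi s \o pi t = pi (s * t)%g &
      forall xi, continuous (fun s => pi s xi)].

Variable mu : {measure set (borelType G) -> \bar R}.

Definition square_integrable (pi : G -> H -> H) : Prop :=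
  exists xi eta : H,
    (\int[mu]_s ((complex.Re `|'[pi s xi, eta]|) ^+ 2)%:E < +oo)%E /\
    ~ {ae mu, forall s, '[pi s xi, eta] = 0}.

Definition factorial_square_integrable (pi : G -> H -> H) : Prop :=
  is_factor (vN_generated pi) /\ square_integrable pi.

End Representations.

Definition rep_twisted (G : preTopGroupType) (omega : borel_cocycle R G)
    (tau : topology_on (circle R * G)) (pi : G -> H -> H) :
    twisted omega tau -> H -> H :=
  fun x xi => circle_val x.1 *: pi x.2 xi.

End Operators.

Arguments rep_twisted {R H G} omega tau pi.

(* A *-isomorphism of von Neumann algebras is automatically normal. *)
Definition quasi_equivalent (R : realType) (H K : hilbert R) (I : Type)
    (pi : I -> H -> H) (rho : I -> K -> K) : Prop :=
  exists Phi : (H -> H) -> (K -> K),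
    let M := vN_generated pi in
    [/\ set_bij M (vN_generated rho) Phi,
        forall (c : cplx R) T U, M T -> M U ->
          Phi (fun x => c *: T x + U x) = fun y => c *: Phi T y + Phi U y,
        forall T U, M T -> M U -> Phi (T \o U) = Phi T \o Phi U,
        forall T, M T -> Phi (adjoint T) = adjoint (Phi T) &
        forall s, Phi (pi s) = rho s].

(* Main.v *)
(* The extension E = T x|_(1, omega) G acts on H with the same commutant as G,
   because the circle acts by scalars; so both representations generate the same
   von Neumann algebra and (b) is linear algebra.

   For (a) one compares the Haar measures: averaging the indicator of a compact
   set over the circle yields a set B of G whose preimage in E has finite positive
   measure, and Tonelli's theorem then shows that the image of the Haar measure of
   E in G is a positive multiple of the Haar measure of G.  Hence square
   integrability and the modular functions agree.

   Strong continuity of the representation of E is not automatic when H is not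
   separable.  The vectors with continuous orbit form a closed invariant subspace
   containing all weak integrals int_K sig(s) x ds over compact sets K, and every
   coefficient of a vector orthogonal to it vanishes almost everywhere.  If H is
   separable such a vector is 0; if the representation is factorial the projection
   onto the subspace is central, hence 0 or 1, and square integrability excludes
   0. *)

Require Import Defs.
From HB Require Import structures.
From mathcomp Require Import all_boot all_order all_algebra.
From mathcomp Require Import sesquilinear complex.
From mathcomp Require Import all_classical all_reals all_analysis.
From mathcomp Require Import measurable_realfun ring lra.
Import Order.TTheory GRing.Theory Num.Theory.
Import numFieldNormedType.Exports.

Set Implicit Arguments.
Unset Strict Implicit.
Unset Printing Implicit Defensive.

Local Open Scope classical_set_scope.
Local Open Scope complex_scope.
Local Open Scope ring_scope.

(** * Real inner products *)

(** The topology of E is tied to that of G only through Borel sets, so the projection E -> G is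
    available as a Borel homomorphism and compact sets of G cannot be pulled back. This is why the
    comparison of measures is stated for a measurable map from an arbitrary measure space, and why a
    set of finite positive measure has to be produced by hand. Vector integrals are defined weakly,
    by Riesz representation of z |-> int_K <sig(s) x, z> ds. The analysis runs on Re <x, y>, which
    keeps these integrals real valued; the imaginary part returns on replacing x by i x. *)

Section ComplexParts.
Variable R : realType.
Implicit Types z w : cplx R.

Lemma ReM z w :
  complex.Re (z * w) = complex.Re z * complex.Re w - complex.Im z * complex.Im w.
Proof. by case: z w => ? ? []. Qed.

Lemma ImM z w :
  complex.Im (z * w) = complex.Re z * complex.Im w + complex.Im z * complex.Re w.
Proof. by case: z w => ? ? []. Qed.

End ComplexParts.

Section RealInnerProduct.
Variables (R : realType) (H : hilbert R).
Implicit Types (x y z : H) (a : R).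

(** The norm and the inner product of [H] are elements of the partially ordered field [cplx R];
    their real parts live in a totally ordered one. *)
Definition rdot x y : R := complex.Re (hdot H x y).
Definition rnorm x : R := complex.Re (`|x| : cplx R).

Lemma hdotC x y : hdot H x y = conjc (hdot H y x).
Proof. by rewrite [LHS](hermC (hdot H) x y) expr0 mul1r. Qed.

Lemma rnormE x : `|x| = (rnorm x)%:C :> cplx R.
Proof.
have : 0 <= (`|x| : cplx R) by [].
rewrite /rnorm; case: (`|x| : cplx R) => a b; rewrite lecE /= => /andP[/eqP -> _].
by [].
Qed.

Lemma rnorm_ge0 x : 0 <= rnorm x.
Proof. by have := normr_ge0 x; rewrite rnormE lecR. Qed.

Lemma rdotDl x y z : rdot (x + y) z = rdot x z + rdot y z.
Proof. by rewrite /rdot linearDl raddfD. Qed.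

Lemma rdotDr x y z : rdot x (y + z) = rdot x y + rdot x z.
Proof. by rewrite /rdot linearDr raddfD. Qed.

Lemma rdotC x y : rdot x y = rdot y x.
Proof. by rewrite /rdot hdotC; case: (hdot H y x). Qed.

Lemma rdotZl a x y : rdot (a%:C *: x) y = a * rdot x y.
Proof.
by rewrite /rdot linearZl_LR ReM /= mul0r subr0.
Qed.

Lemma rdotZr a x y : rdot x (a%:C *: y) = a * rdot x y.
Proof. by rewrite rdotC rdotZl rdotC. Qed.

Lemma rdotNl x y : rdot (- x) y = - rdot x y.
Proof. by rewrite /rdot linearNl raddfN. Qed.

Lemma rdotNr x y : rdot x (- y) = - rdot x y.
Proof. by rewrite rdotC rdotNl rdotC. Qed.

Lemma rdotBl x y z : rdot (x - y) z = rdot x z - rdot y z.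
Proof. by rewrite rdotDl rdotNl. Qed.

Lemma rdotBr x y z : rdot x (y - z) = rdot x y - rdot x z.
Proof. by rewrite rdotDr rdotNr. Qed.

Lemma rdot0l x : rdot 0 x = 0. Proof. by rewrite /rdot linear0l. Qed.
Lemma rdot0r x : rdot x 0 = 0. Proof. by rewrite rdotC rdot0l. Qed.

Lemma rdotxx x : rdot x x = rnorm x ^+ 2.
Proof. by rewrite /rdot -hdot_norm rnormE -rmorphXn. Qed.

Lemma rnorm_eq0 x : rnorm x = 0 -> x = 0.
Proof. by move=> x0; apply/normr0_eq0; rewrite rnormE x0. Qed.

Lemma rdotxx_eq0 x : rdot x x = 0 -> x = 0.
Proof. by rewrite rdotxx => /eqP; rewrite sqrf_eq0 => /eqP /rnorm_eq0. Qed.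

Lemma rnorm_gt0 x : x != 0 -> 0 < rnorm x.
Proof.
move=> x0; rewrite lt_neqAle rnorm_ge0 andbT eq_sym.
by apply: contra x0 => /eqP /rnorm_eq0 ->.
Qed.

Lemma rnorm0 : rnorm 0 = 0. Proof. by rewrite /rnorm normr0. Qed.

Lemma rnormD x y : rnorm (x + y) <= rnorm x + rnorm y.
Proof. by have := ler_normD x y; rewrite !rnormE -rmorphD lecR. Qed.

Lemma rnormN x : rnorm (- x) = rnorm x.
Proof. by rewrite /rnorm normrN. Qed.

Lemma rnormBC x y : rnorm (x - y) = rnorm (y - x).
Proof. by rewrite -rnormN opprB. Qed.

Lemma rnormZ a x : rnorm (a%:C *: x) = `|a| * rnorm x.
Proof.
have : (`|a%:C *: x| : cplx R) = `|a%:C : cplx R| * `|x| by rewrite normrZ.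
have -> : `|a%:C : cplx R| = (`|a|)%:C.
  by rewrite normc_def /= expr0n addr0 sqrtr_sqr.
by rewrite !rnormE -rmorphM => -[].
Qed.

Lemma rdot_le x y : rdot x y <= rnorm x * rnorm y.
Proof.
have [->|x0] := eqVneq x 0; first by rewrite rdot0l rnorm0 mul0r.
have nx0 := rnorm_gt0 x0.
have [->|y0] := eqVneq y 0; first by rewrite rdot0r rnorm0 mulr0.
have ny0 := rnorm_gt0 y0.
(* Expanding |u|^2 >= 0 gives 2 |x| |y| (|x| |y| - <x, y>) >= 0. *)
pose u := (rnorm y)%:C *: x - (rnorm x)%:C *: y.
have : 0 <= rdot u u by rewrite rdotxx sqr_ge0.
rewrite /u !rdotBl !rdotBr !rdotZl !rdotZr !rdotxx (rdotC y x) => h.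
rewrite -(ler_pM2l (mulr_gt0 nx0 ny0)).
by nra.
Qed.

Lemma normr_rdot x y : `|rdot x y| <= rnorm x * rnorm y.
Proof.
by rewrite ler_norml rdot_le andbT lerNl -rdotNl -(rnormN x) rdot_le.
Qed.

Lemma Im_hdot x y : complex.Im (hdot H x y) = - rdot ('i *: x) y.
Proof.
by rewrite /rdot linearZl_LR ReM /=; ring.
Qed.

Lemma rdot_nondeg x y : (forall z, rdot x z = rdot y z) -> x = y.
Proof.
move=> h; apply/eqP; rewrite -subr_eq0; apply/eqP/rdotxx_eq0.
by rewrite rdotBl h subrr.
Qed.

(** Balls of [H] have radii in [cplx R], where 0 < e forces e to be real; hence real radii
    suffice. *)
Lemma nbhs_rnormP x (A : set H) :
  nbhs x A <-> exists2 e : R, 0 < e & forall y, rnorm (x - y) < e -> A y.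
Proof.
split.
  case/nbhs_ballP => -[e e'] /=; rewrite ltcE /= => /andP[/eqP e'0 e0] h.
  exists e => // y xy; apply: h; rewrite -ball_normE /= rnormE.
  by rewrite ltcE /= e'0 eqxx.
move=> [e e0 h]; apply/nbhs_ballP; exists e%:C => /=; first by rewrite ltcR.
by move=> y; rewrite -ball_normE /= rnormE ltcR => /h.
Qed.

End RealInnerProduct.

(** * Minimization over closed subspaces *)

Section Riesz.
Variables (R : realType) (H : hilbert R).
Implicit Types (x y z : H) (a : R).

Lemma rnorm_complete (u : nat -> H) :
  (forall e : R, 0 < e -> exists N, forall m n, (N <= m)%N -> (N <= n)%N ->
     rnorm (u m - u n) < e) ->
  exists l : H, forall e : R, 0 < e -> exists N, forall n, (N <= n)%N ->
     rnorm (l - u n) < e.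
Proof.
move=> hu.
have : cauchy (u @ \oo).
  apply/cauchy_ballP => -[e e'] /=; rewrite ltcE /= => /andP[/eqP e'0 e0].
  have [N hN] := hu e e0.
  near=> p; rewrite -ball_normE /= rnormE ltcE /= e'0 eqxx /=.
  have [m [n [Nm Nn -> ->]]] : exists m n,
      [/\ (N <= m)%N, (N <= n)%N, p.1 = u m & p.2 = u n].
    near: p; exists (u @` [set m | (N <= m)%N], u @` [set m | (N <= m)%N]) => /=.
      by split; exists N => // m /= Nm; exists m.
    by move=> [q1 q2] /= [[m Nm <-] [n Nn <-]]; exists m, n.
  exact: hN.
move=> /cauchy_cvg /cvg_ex [l hl]; exists l => e e0.
have : nbhs l [set y | rnorm (l - y) < e] by apply/nbhs_rnormP; exists e.
by move=> /hl [N _ hN]; exists N => n Nn; exact: hN.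
Unshelve. all: by end_near.
Qed.

Lemma closed_rnorm (V : set H) (u : nat -> H) l : closed V ->
  (forall n, V (u n)) ->
  (forall e : R, 0 < e -> exists N, forall n, (N <= n)%N ->
     rnorm (l - u n) < e) -> V l.
Proof.
move=> cV Vu hl; apply: cV => B /nbhs_rnormP[e e0 hB].
have [N hN] := hl e e0.
by exists (u N); split => //; apply: hB; apply: hN.
Qed.

(* v minimizes |z|^2 - 2 L z over V; V = H gives the Riesz theorem, and
   L = <x, -> gives the orthogonal projection onto V. *)
Lemma riesz_subspace (V : set H) (L : H -> R) (M : R) :
  V 0 -> (forall x y, V x -> V y -> V (x + y)) ->
  (forall a x, V x -> V (a%:C *: x)) -> closed V ->
  (forall x y, L (x + y) = L x + L y) -> (forall a x, L (a%:C *: x) = a * L x) ->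
  (forall x, `|L x| <= M * rnorm x) ->
  exists2 v, V v & forall z, V z -> rdot v z = L z.
Proof.
move=> V0 VD VZ cV LD LZ LM.
pose J z := rdot z z - 2 * L z.
(* |z|^2 - 2 M |z| >= - M^2 by completing the square. *)
have Jlb z : - (M ^+ 2) <= J z.
  have := LM z; have := rnorm_ge0 z; rewrite /J rdotxx ler_norml.
  by have := sqr_ge0 (rnorm z - M) => h0 h1 /andP[h2 h3]; lra.
pose S := [set J z | z in V].
have S0 : S !=set0 by exists (J 0), 0.
have lbS : has_lbound S by exists (- (M ^+ 2)) => _ [z _ <-].
have hiS : has_inf S by [].
have Jinf z : V z -> inf S <= J z by move=> Vz; apply: ge_inf => //; exists z.
have pn0 n : 0 < (n.+1%:R : R)^-1 by rewrite invr_gt0.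
have /choice[u hu] n : exists z, V z /\ J z < inf S + n.+1%:R^-1.
  have [_ [z Vz <-] h] := inf_adherent (pn0 n) hiS.
  by exists z.
have JD x y : J (x + y) = J x + J y + 2 * rdot x y.
  by rewrite /J rdotDl !rdotDr (rdotC y x) LD; ring.
have JZ a z : J (a%:C *: z) = a ^+ 2 * rdot z z - 2 * a * L z.
  by rewrite /J rdotZl rdotZr LZ; ring.
(* Parallelogram law: |x - y|^2 = 2 J x + 2 J y - 4 J((x + y) / 2), and the midpoint lies in [V]. *)
have Jpar x y : V x -> V y ->
    rdot (x - y) (x - y) <= 2 * (J x + J y - 2 * inf S).
  move=> Vx Vy; have := Jinf _ (VZ (2^-1) _ (VD _ _ Vx Vy)).
  rewrite JZ LD /J !(rdotBl, rdotBr, rdotDl, rdotDr) (rdotC y x) => h.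
  set i := inf S in h *.
  have e : (2^-1 : R) ^+ 2 = 4^-1 by field.
  by rewrite e divff ?pnatr_eq0// mul1r in h; lra.
have small (e : R) : 0 < e -> exists N, forall n, (N <= n)%N -> n.+1%:R^-1 < e.
  move=> e0; have [N _ hN] := near_infty_natSinv_lt (PosNum e0).
  by exists N => n /hN.
have [v hv] : exists l : H, forall e : R, 0 < e -> exists N, forall n,
    (N <= n)%N -> rnorm (l - u n) < e.
  apply: rnorm_complete => e e0.
  (* With 1/(m+1) and 1/(n+1) below e^2 / 4, the parallelogram bound stays below e^2. *)
  have [N hN] := small (e ^+ 2 / 4) ltac:(by rewrite divr_gt0 ?exprn_gt0).
  exists N => m n /hN hm /hN hn.
  have := Jpar _ _ (hu m).1 (hu n).1; have := (hu m).2; have := (hu n).2.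
  rewrite rdotxx -[rnorm _ < e](ltr_pXn2r (n := 2)) ?nnegrE ?rnorm_ge0 ?(ltW e0)//.
  by move: hm hn; set i := inf S; set p := m.+1%:R^-1; set q := n.+1%:R^-1; lra.
have Vv : V v by apply: closed_rnorm cV _ hv => n; exact: (hu n).1.
exists v => // z Vz.
set c := rdot v z - L z.
(* This is J(v + t z) >= J v, obtained up to every e > 0 from the minimizing sequence [u]. The
   summand 1 in [k] keeps it positive. *)
have key t : 0 <= 2 * t * c + t ^+ 2 * rdot z z.
  apply/ler_addgt0Pl => e e0.
  pose k := 2 * `|t| * rnorm z + 1.
  have k0 : 0 < k.
    by rewrite ltr_wpDl// !mulr_ge0// rnorm_ge0.
  have [N1 h1] := small (e / 2) ltac:(by rewrite divr_gt0).
  have [N2 h2] := hv (e / 2 / k) ltac:(by rewrite !divr_gt0).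
  pose n := maxn N1 N2.
  have {}h1 := h1 n (leq_maxl _ _); have {}h2 := h2 n (leq_maxr _ _).
  have := Jinf _ (VD _ _ (hu n).1 (VZ t _ Vz)).
  rewrite JD JZ rdotZr; have := (hu n).2; set i := inf S => a1 a2.
  have a3 : 2 * t * (rdot (u n) z - rdot v z) <= e / 2.
    rewrite -rdotBl (le_trans (ler_norm _))// normrM normrM ger0_norm//.
    have := normr_rdot (u n - v) z; rewrite rnormBC => b1.
    have b2 : 2 * `|t| * `|rdot (u n - v) z| <= rnorm (v - u n) * k.
      have : 2 * `|t| * `|rdot (u n - v) z| <=
        2 * `|t| * (rnorm (v - u n) * rnorm z) by rewrite ler_wpM2l// mulr_ge0.
      have := rnorm_ge0 (v - u n); rewrite /k; set r := rnorm (v - u n).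
      by move=> *; lra.
    apply: (le_trans b2); rewrite -ler_pdivlMr//; exact: ltW.
  move: h1 a1 a2 a3; rewrite /c; set q := n.+1%:R^-1; set j := J _.
  by lra.
have N0 : 0 <= rdot z z by rewrite rdotxx sqr_ge0.
(* Nearly the minimizer - c / |z|^2 of the quadratic in t; the added 1 also covers z = 0. *)
have := key (- c / (rdot z z + 1)).
set N := rdot z z in N0 *; have N1 : 0 < N + 1 by lra.
have -> : 2 * (- c / (N + 1)) * c + (- c / (N + 1)) ^+ 2 * N =
   - (c ^+ 2 * (N + 2)) / (N + 1) ^+ 2 by field; rewrite gt_eqF.
rewrite pmulr_lge0 ?invr_gt0 ?exprn_gt0// => h.
have : c ^+ 2 <= 0 by have := sqr_ge0 c; nra.
move=> h'; have : c ^+ 2 == 0 by rewrite eq_le h' sqr_ge0.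
by rewrite sqrf_eq0 subr_eq0 => /eqP.
Qed.

End Riesz.

(** * Borel sets of second countable spaces *)

Section Borel.

Lemma second_countable_seq (X : ptopologicalType) : @second_countable X ->
  exists b : nat -> set X, (forall n, open (b n)) /\
    forall x U, nbhs x U -> exists n, b n x /\ b n `<=` U.
Proof.
move=> [B /pfcard_geP[B0|[f]] [Bo Bn]].
  by have [U []] := Bn point setT filterT; rewrite B0.
exists f; split=> [n|x U /Bn[V [BV Vx] VU]].
  by apply: Bo; exact: (@funS _ _ _ _ f).
by have [n _ fn] := @surj _ _ _ _ f _ BV; exists n; rewrite fn.
Qed.

(** Second countability makes an open set a countable union of open rectangles. Multiplication
    thereby becomes measurable for the product of the Borel sigma-algebras, the one on which
    Tonelli's theorem operates. *)
Lemma open_prod_measurable (X Y : ptopologicalType) (O : set (X * Y)) :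
  @second_countable X -> @second_countable Y -> open O ->
  measurable (O : set (borelType X * borelType Y)%type).
Proof.
move=> /second_countable_seq[a [ao ha]] /second_countable_seq[b [bo hb]] oO.
have -> : O = \bigcup_(k : nat * nat)
    (if `[< a k.1 `*` b k.2 `<=` O >] then a k.1 `*` b k.2 else set0).
  apply/seteqP; split=> [[x y] Oxy|[x y] [[n m] _]]; last first.
    by case: asboolP => //= h anm; apply: h.
  have /= : nbhs (x, y) O by exact: open_nbhs_nbhs.
  move=> [[U V] [/= /ha[n [anx anU]] /hb[m [bmy bmV]]] UVO].
  exists (n, m) => //; case: asboolP => //= -[] [u v] [/= au bv].
  by apply: UVO; split; [exact: anU|exact: bmV].
apply: countable_bigcupT_measurable => [|k]; first exact: countableP.
case: ifP => // _; apply: measurableX; apply: sub_sigma_algebra.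
  exact: ao.
exact: bo.
Qed.

Lemma borel_measurable_fun d (T : measurableType d) (X : ptopologicalType)
    (f : T -> X) :
  (forall O, open O -> measurable (f @^-1` O)) ->
  measurable_fun setT (f : T -> borelType X).
Proof.
move=> h; apply: (@measurability _ _ _ (borelType X) _ _ (@open X)) => //.
by move=> _ [U oU <-]; rewrite setTI; exact: h.
Qed.

Lemma continuous_borel (X Y : ptopologicalType) (f : X -> Y) : continuous f ->
  measurable_fun setT (f : borelType X -> borelType Y).
Proof.
move=> /continuousP h; apply: borel_measurable_fun => O oO.
by apply: sub_sigma_algebra; exact: h.
Qed.

Lemma continuous2_borel (X Y Z : ptopologicalType) (f : X * Y -> Z) :
  @second_countable X -> @second_countable Y -> continuous f ->
  measurable_fun setT (f : borelType X * borelType Y -> borelType Z).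
Proof.
move=> sX sY /continuousP h; apply: borel_measurable_fun => O oO.
by apply: open_prod_measurable => //; exact: h.
Qed.

Lemma sigma_compact (X : ptopologicalType) :
  locally_compact [set: X] -> @second_countable X ->
  exists K : nat -> set X, (forall n, compact (K n)) /\ \bigcup_n K n = setT.
Proof.
move=> lc /second_countable_seq[b [bo hb]].
exists (fun n => if `[< compact (closure (b n)) >] then closure (b n) else set0).
split=> [n|]; first by case: asboolP => // _; exact: compact0.
apply/seteqP; split=> // x _; have [U] := lc x Logic.I.
rewrite withinET => /hb[n [bx bU]] [cU clU]; exists n => //.
case: asboolP => [_|[]]; first exact: subset_closure.
apply: (subclosed_compact _ cU); first exact: closed_closure.
by move/closure_id: clU => ->; exact: closureS.
Qed.

Lemma compact_borel (X : ptopologicalType) (K : set X) :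
  hausdorff_space X -> compact K -> measurable (K : set (borelType X)).
Proof.
move=> hX cK; rewrite -(setCK K); apply: measurableC; apply: sub_sigma_algebra.
by apply: closed_openC; exact: compact_closed.
Qed.

(** By sigma-compactness every closed set is a countable union of compact ones. Compact sets thus
    form a generating pi-system on which measures can be compared. *)
Lemma borel_compact (X : ptopologicalType) : hausdorff_space X ->
  locally_compact [set: X] -> @second_countable X ->
  (measurable : set (set (borelType X))) = <<s @compact X >>.
Proof.
move=> hX lc sc; apply/seteqP; split; last first.
  apply: smallest_sub => [|K cK]; first exact: sigma_algebra_measurable.
  exact: compact_borel.
apply: smallest_sub => [|O oO]; first exact: smallest_sigma_algebra.
have [K [cK KT]] := sigma_compact lc sc.
have [_ sC sU] := smallest_sigma_algebra (setT : set X) (@compact X).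
suff h : <<s @compact X >> (~` O) by have := sC _ h; rewrite setTD setCK.
have -> : ~` O = \bigcup_n (K n `&` ~` O) by rewrite -setI_bigcupl KT setTI.
apply: sU => n.
apply: sub_sigma_algebra; apply: compact_closedI => //.
exact: open_closedC.
Qed.

End Borel.

(** * Uniqueness of Haar measure *)

Section Haar.
Variables (R : realType) (G : preTopGroupType).
Hypothesis hG : lcsc_group G.
Local Notation bG := (borelType G).

Lemma measurable_mulg : measurable_fun setT
  ((fun p : G * G => (p.1 * p.2)%g) : bG * bG -> bG).
Proof. by have [? _ _ _ ?] := hG; exact: continuous2_borel. Qed.

Lemma measurable_invg : measurable_fun setT ((fun x : G => x^-1%g) : bG -> bG).
Proof. by have [_ ? _ _ _] := hG; exact: continuous_borel. Qed.

Lemma measurable_fun_mulg d (T : measurableType d) (f g : T -> bG) :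
  measurable_fun setT f -> measurable_fun setT g ->
  measurable_fun setT (fun t => (f t * g t)%g : bG).
Proof.
by move=> mf mg; exact: (measurableT_comp measurable_mulg
  (measurable_fun_pair mf mg)).
Qed.

Lemma measurable_fun_invg d (T : measurableType d) (f : T -> bG) :
  measurable_fun setT f -> measurable_fun setT (fun t => (f t)^-1%g : bG).
Proof. by move=> mf; exact: (measurableT_comp measurable_invg mf). Qed.

Lemma measurable_preimageT d d' (T : measurableType d) (T' : measurableType d')
  (f : T -> T') A : measurable_fun setT f -> measurable A ->
  measurable (f @^-1` A).
Proof. by move=> mf mA; rewrite -[X in measurable X]setTI; exact: mf. Qed.

Lemma lmul_preimage (s : G) (A : set G) :
  (fun x => (s * x)%g) @^-1` A = [set (s^-1 * x)%g | x in A].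
Proof.
apply/seteqP; split=> [x /= Ax|_ [x Ax <-]]; last by rewrite /= mulVKg.
by exists (s * x)%g => //; rewrite mulKg.
Qed.

Lemma rmul_preimage (s : G) (A : set G) :
  (fun x => (x * s)%g) @^-1` A = [set (x * s^-1)%g | x in A].
Proof.
apply/seteqP; split=> [x /= Ax|_ [x Ax <-]]; last by rewrite /= mulgVK.
by exists (x * s)%g => //; rewrite mulgK.
Qed.

Variable mu : {measure set bG -> \bar R}.
Hypothesis hmu : left_haar mu.

Lemma left_haar_preimage (s : G) (A : set G) : measurable (A : set bG) ->
  mu ((fun x => (s * x)%g) @^-1` A) = mu A.
Proof. by have [_ _ h] := hmu => mA; rewrite lmul_preimage h. Qed.

Lemma left_haar_sigma_finite : sigma_finite setT mu.
Proof.
have [_ _ sep lc sc] := hG; have [K [cK KT]] := sigma_compact lc sc.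
exists K; first by [].
by move=> n; split; [exact: compact_borel|have [_ h _] := hmu; exact: h].
Qed.

Lemma left_haar_compact_pos : exists K : set G, compact K /\ (0 < mu K)%E.
Proof.
have [_ _ sep lc sc] := hG; have [K [cK KT]] := sigma_compact lc sc.
apply: contrapT => /forallNP h; have [mu0 _ _] := hmu; apply: mu0.
apply/eqP; rewrite eq_le measure_ge0 andbT -KT.
apply: (le_trans (generalized_Boole_inequality _ _ _)) => [n||].
- exact: compact_borel.
- by apply: bigcupT_measurable => n; exact: compact_borel.
- rewrite eseries0// => n _ _; apply/eqP; rewrite eq_le measure_ge0 andbT.
  by rewrite leNgt; apply/negP => h0; exact: (h (K n)).
Qed.

End Haar.

(** Sigma-finiteness of a Haar measure is a proved property, whereas Tonelli's theorem expects it in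
    the structure of the measure; this turns the one into the other. *)
Definition sigma_finite_pack d (T : measurableType d) (R : realType)
    (m : {measure set T -> \bar R}) (sf : sigma_finite setT m) :
    {sigma_finite_measure set T -> \bar R} :=
  let H1 := isSFinite.Build _ _ _ (Measure.sort m)
    (sfinite_measure_sigma_finite sf) in
  let H2 := isSigmaFinite.Build _ _ _ (Measure.sort m) sf in
  HB.pack_for {sigma_finite_measure set T -> \bar R} (Measure.sort m) H1 H2.

Lemma sigma_finite_measurable_xsection d1 d2 (T1 : measurableType d1)
    (T2 : measurableType d2) (R : realType) (m : {measure set T2 -> \bar R})
    (S : set (T1 * T2)) : sigma_finite setT m -> measurable S ->
  measurable_fun [set: T1] (m \o xsection S).
Proof.
move=> sf mS.
exact: (@measurable_fun_xsection _ _ _ _ _ (sigma_finite_pack sf) _ mS).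
Qed.

Lemma sigma_finite_tonelli_section d1 d2 (T1 : measurableType d1)
    (T2 : measurableType d2) (R : realType) (m1 : {measure set T1 -> \bar R})
    (m2 : {measure set T2 -> \bar R}) (S : set (T1 * T2)) :
  sigma_finite setT m1 -> sigma_finite setT m2 -> measurable S ->
  (\int[m1]_x m2 (xsection S x) = \int[m2]_y m1 (ysection S y))%E.
Proof.
move=> sf1 sf2 mS; have := @indic_fubini_tonelli _ _ _ _ _
  (sigma_finite_pack sf1) (sigma_finite_pack sf2) S mS.
by rewrite indic_fubini_tonelli_FE// indic_fubini_tonelli_GE.
Qed.

(** * Invariant measures lying over G *)

Section HaarComparison.
Variables (R : realType) (G : preTopGroupType).
Hypothesis hG : lcsc_group G.
Local Notation bG := (borelType G).
Variables (mu : {measure set bG -> \bar R}) (Delta : G -> R).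
Hypotheses (hmu : left_haar mu) (hDelta : modular_function mu Delta).
Variables (d : measure_display) (X : measurableType d).
Variables (nu : {measure set X -> \bar R}) (p : X -> bG).
Hypotheses (nu_sf : sigma_finite setT nu) (mp : measurable_fun setT p).
Hypothesis nu_inv : forall (s : G) (A : set G), measurable (A : set bG) ->
  nu (p @^-1` ((fun x => (s * x)%g) @^-1` A)) = nu (p @^-1` A).

Lemma modular_preimage (s : G) (A : set G) : measurable (A : set bG) ->
  mu ((fun x => (x * s)%g) @^-1` A) = ((Delta s)^-1%:E * mu A)%E.
Proof.
move=> mA; have [D0 hD] := hDelta.
have mA' : measurable ((fun x => (x * s)%g) @^-1` A : set bG).
  apply: (measurable_preimageT (T' := borelType G)) => //.
  exact: measurable_fun_mulg.
have e : [set (x * s)%g | x in (fun x => (x * s)%g) @^-1` A] = A.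
  apply/seteqP; split=> [_ [x Ax <-] //|x Ax].
  by exists (x * s^-1)%g; rewrite /= mulgVK.
by rewrite -[in RHS]e hD// muleA -EFinM mulVf ?mul1e// gt_eqF.
Qed.

(* Tonelli applied to {(x, y) | p x \in A, y p(x) \in B}: integrating over y
   first brings in the modular function, while the left translation x -> y^-1 x
   for nu and the change of variables y -> p(x) y for mu turn the other order
   into nu(B) mu(A^-1). *)
Lemma haar_comparison_eq (A B : set G) :
  measurable (A : set bG) -> measurable (B : set bG) ->
  (mu ((fun x => x^-1%g) @^-1` A) * nu (p @^-1` B) =
   \int[nu]_x ((\1_(p @^-1` A) x * (Delta (p x))^-1)%:E * mu B))%E.
Proof.
move=> mA mB.
pose S1 := [set z : X * G | A (p z.1) /\ B (z.2 * p z.1)%g].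
pose S2 := [set z : X * G | B (p z.1) /\ A (z.2^-1 * p z.1)%g].
have mp1 : measurable_fun setT (fun z : X * bG => p z.1).
  exact: measurableT_comp.
have m2 : measurable_fun setT (fun z : X * bG => z.2) by exact: measurable_snd.
have mS1 : measurable (S1 : set (X * bG)).
  apply: measurableI; first exact: measurable_preimageT mp1 mA.
  apply: (measurable_preimageT
    (f := fun z : X * bG => (z.2 * p z.1)%g : bG)) => //.
  exact: measurable_fun_mulg.
have mS2 : measurable (S2 : set (X * bG)).
  apply: measurableI; first exact: measurable_preimageT mp1 mB.
  apply: (measurable_preimageT
    (f := fun z : X * bG => (z.2^-1 * p z.1)%g : bG)) => //.
  by apply: measurable_fun_mulg => //; exact: measurable_fun_invg.
transitivity (\int[nu]_x mu (xsection S2 x))%E.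
  have mB' : measurable (p @^-1` B) by exact: measurable_preimageT.
  transitivity (\int[nu]_x
    (mu ((fun x => x^-1%g) @^-1` A) * (\1_(p @^-1` B) x)%:E))%E.
    rewrite ge0_integralZl//; first by rewrite integral_indic// setIT.
    exact/measurable_EFinP/measurable_indic.
  apply: eq_integral => x _; rewrite indicE.
  have [Bx|nBx] := boolP (x \in p @^-1` B); rewrite ?mule1 ?mule0.
    rewrite -(left_haar_preimage hmu (p x)^-1%g); last first.
      apply: (measurable_preimageT (T' := borelType G)) => //.
      exact: measurable_invg.
    congr (mu _); apply/seteqP; split=> y; rewrite /xsection /= inE /S2 /=.
      by rewrite invgM invgK => Ay; split => //; rewrite inE in Bx.
    by rewrite invgM invgK => -[].
  rewrite (_ : xsection S2 x = set0) ?measure0//.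
  apply/seteqP; split=> y //; rewrite /xsection /= inE /S2 /= => -[Bx _].
  by move: nBx; rewrite notin_setE.
transitivity (\int[nu]_x mu (xsection S1 x))%E.
  rewrite !(sigma_finite_tonelli_section nu_sf (left_haar_sigma_finite hG hmu))//.
   apply: eq_integral => y _.
  have -> : ysection S2 y = p @^-1` (B `&` (fun x => (y^-1 * x)%g) @^-1` A).
    by apply/seteqP; split=> x; rewrite /ysection /= inE.
  rewrite -(nu_inv y); last first.
    apply: measurableI => //; apply: (measurable_preimageT (T' := borelType G)) => //.
    exact: measurable_fun_mulg.
  congr (nu _); apply/seteqP; split=> x; rewrite /ysection /= inE /S1 /= mulKg.
    by case.
  by case.
apply: eq_integral => x _; rewrite indicE.
have [Ax|nAx] := boolP (x \in p @^-1` A).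
  rewrite mul1r -modular_preimage//; congr (mu _).
  apply/seteqP; split=> y; rewrite /xsection /= inE /S1 /=; first by case.
  by move=> By; split => //; rewrite inE in Ax.
rewrite mul0r mul0e (_ : xsection S1 x = set0) ?measure0//.
apply/seteqP; split=> y //; rewrite /xsection /= inE /S1 /= => -[Ax _].
by move: nAx; rewrite notin_setE.
Qed.

(** Taking for A^-1 a compact K of positive measure turns the preceding identity into mu(K) nu(p^-1
    B) = W mu(B) with W independent of B; [B1] serves to show 0 < W < +oo. *)
Lemma haar_comparison (B1 : set G) : measurable (B1 : set bG) ->
  (0 < nu (p @^-1` B1) < +oo)%E ->
  exists2 k : R, 0 < k & forall B : set G, measurable (B : set bG) ->
    nu (p @^-1` B) = (k%:E * mu B)%E.
Proof.
move=> mB1 /andP[B1_gt0 B1_oo].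
have [K [cK K0]] := left_haar_compact_pos hG hmu.
have [_ muK_oo _] := hmu; have {muK_oo} Koo := muK_oo _ cK.
have [_ _ sep _ _] := hG.
have mK : measurable (K : set bG) by exact: compact_borel.
pose A := (fun x : G => x^-1%g) @^-1` K.
have mA : measurable (A : set bG).
  apply: (measurable_preimageT (T' := borelType G)) => //.
  exact: measurable_invg.
have AK : (fun x : G => x^-1%g) @^-1` A = K.
  by apply/seteqP; split=> x; rewrite /A /= invgK.
pose w x := (\1_(p @^-1` A) x * (Delta (p x))^-1)%R.
have [D0 _] := hDelta.
have w0 x : 0 <= w x by rewrite mulr_ge0// invr_ge0 ltW.
have muKE : mu K = (fine (mu K))%:E by rewrite fineK// ge0_fin_numE.
have k0 : 0 < fine (mu K) by rewrite -lte_fin -muKE.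
(* [Delta] comes without measurability. Up to the factor mu(K), [w] is the measure of a section of a
   measurable set, which depends measurably on x. *)
have mw : measurable_fun setT (EFin \o w).
  pose S1 := [set z : X * G | A (p z.1) /\ K (z.2 * p z.1)%g].
  have mS1 : measurable (S1 : set (X * bG)).
    apply: measurableI.
      apply: (measurable_preimageT (f := fun z : X * bG => p z.1)) => //.
      exact: measurableT_comp.
    apply: (measurable_preimageT
    (f := fun z : X * bG => (z.2 * p z.1)%g : bG)) => //.
    by apply: measurable_fun_mulg => //; exact: measurableT_comp.
  have -> : EFin \o w = (fun x => (fine (mu K))^-1%:E * mu (xsection S1 x))%E.
    apply/funext => x /=; rewrite /w indicE.
    have [Ax|nAx] := boolP (x \in p @^-1` A).
      rewrite (_ : xsection S1 x = (fun y => (y * p x)%g) @^-1` K); last first.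
        apply/seteqP; split=> y; rewrite /xsection /= inE /S1 /=; first by case.
        by move=> By; split => //; rewrite inE in Ax.
      rewrite modular_preimage// muKE mul1r -!EFinM; congr EFin.
      by field; rewrite !gt_eqF.
    rewrite mul0r (_ : xsection S1 x = set0) ?measure0 ?mule0//.
    apply/seteqP; split=> y //; rewrite /xsection /= inE /S1 /= => -[Ax _].
    by move: nAx; rewrite notin_setE.
  apply: measurable_funeM.
  exact: (sigma_finite_measurable_xsection (left_haar_sigma_finite hG hmu) mS1).
have key B : measurable (B : set bG) ->
    (mu K * nu (p @^-1` B) = (\int[nu]_x (w x)%:E) * mu B)%E.
  move=> mB; rewrite -{1}AK haar_comparison_eq// ge0_integralZr//.
  by move=> x _; rewrite lee_fin; exact: w0.
have W0 : (0 <= \int[nu]_x (w x)%:E)%E.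
  by apply: integral_ge0 => x _; rewrite lee_fin.
(* W = +oo would make mu(K) nu(p^-1 B1) equal to 0 or +oo according to whether mu(B1) vanishes; both
   contradict the choice of [B1]. *)
move: W0 key; case: (\int[nu]_x (w x)%:E)%E => [r r0 key|_ key|//]; last first.
  have := key B1 mB1; have := measure_ge0 mu B1.
  rewrite le_eqVlt => /predU1P[<-|mB0].
    by rewrite mule0 => /eqP; rewrite mule_eq0 !gt_eqF.
  rewrite gt0_mulye// muKE => h.
  have : ((fine (mu K))%:E * nu (p @^-1` B1) < +oo)%E.
    by apply: lte_mul_pinfty => //; rewrite lee_fin ltW.
  by rewrite h ltxx.
have r_gt0 : 0 < r.
  rewrite lt_neqAle -lee_fin r0 andbT; apply/eqP => r0'; have := key B1 mB1.
  by rewrite -r0' mul0e => /eqP; rewrite mule_eq0 !gt_eqF.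
exists (r / fine (mu K)); first by rewrite divr_gt0.
move=> B /key; rewrite muKE => h.
by rewrite mulrC EFinM -muleA -h muleA -EFinM mulVf ?mul1e// gt_eqF.
Qed.

End HaarComparison.

(** * The circle *)

Section ComplexTopology.
Variable R : realType.
Implicit Types z w : cplx R.

Lemma normr_Re_le z (e : R) : `|z| < e%:C -> `|complex.Re z| < e.
Proof. by move=> ze; rewrite -ltcR; exact: le_lt_trans (normc_ge_Re z) ze. Qed.

Lemma normr_Im_le z (e : R) : `|z| < e%:C -> `|complex.Im z| < e.
Proof.
move=> ze; have := @normr_Re_le ('i * z) e; rewrite ReM /= mul0r mul1r sub0r.
rewrite normrN; apply; rewrite normrM (_ : `|'i : cplx R| = 1) ?mul1r//.
by rewrite normc_def /= expr0n /= expr1n add0r sqrtr1.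
Qed.

Lemma nbhs_cplxP z (A : set (cplx R)) :
  nbhs z A <-> exists2 e : R, 0 < e & forall w,
    `|complex.Re z - complex.Re w| < e -> `|complex.Im z - complex.Im w| < e ->
    A w.
Proof.
split.
  case/nbhs_ballP => -[e e'] /=; rewrite ltcE /= => /andP[/eqP e'0 e0] h.
  exists (e / 2); first by rewrite divr_gt0.
  move=> w hr hi; apply: h; rewrite -ball_normE /= e'0 -[_ +i* 0]/(e%:C).
  rewrite normc_def ltcR -[ltRHS]ger0_norm ?(ltW e0)// -sqrtr_sqr.
  rewrite ltr_sqrt ?exprn_gt0//.
  move: hr hi; rewrite !raddfB; set a := _ - _; set b := _ - _ => /= hr hi.
  have e2 : 0 <= e / 2 by rewrite ltW// divr_gt0.
  have : `|a| ^+ 2 < (e / 2) ^+ 2 by rewrite ltr_pXn2r ?nnegrE.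
  have : `|b| ^+ 2 < (e / 2) ^+ 2 by rewrite ltr_pXn2r ?nnegrE.
  rewrite !real_normK ?num_real// => h1 h2; have := sqr_ge0 e.
  by rewrite expr_div_n in h1 h2; nra.
move=> [e e0 h]; apply/nbhs_ballP; exists e%:C => /=; first by rewrite ltcR.
move=> w; rewrite -ball_normE /= => zw.
by apply: h; rewrite -raddfB; [exact: normr_Re_le|exact: normr_Im_le].
Qed.

Lemma measurable_Re :
  measurable_fun setT (@complex.Re R : borelType (cplx R) -> R).
Proof.
apply: (measurability _ (RGenOInfty.measurableE R)) => _ [_ [x ->] <-].
rewrite setTI; apply: sub_sigma_algebra.
rewrite openE => z /=; rewrite in_itv /= andbT => xz.
apply/nbhs_cplxP; exists (complex.Re z - x); first by rewrite subr_gt0.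
by move=> w /ltr_distlDr h _ /=; rewrite in_itv /= andbT; lra.
Qed.

Lemma measurable_Im :
  measurable_fun setT (@complex.Im R : borelType (cplx R) -> R).
Proof.
apply: (measurability _ (RGenOInfty.measurableE R)) => _ [_ [x ->] <-].
rewrite setTI; apply: sub_sigma_algebra.
rewrite openE => z /=; rewrite in_itv /= andbT => xz.
apply/nbhs_cplxP; exists (complex.Im z - x); first by rewrite subr_gt0.
by move=> w _ /ltr_distlDr h /=; rewrite in_itv /= andbT; lra.
Qed.

(** An open set of the plane is a countable union of squares with rational centre and radius
    1/(n+1), and the preimage of a square is an intersection of two strips given by the real and
    imaginary parts. *)
Lemma measurable_cplx d (T : measurableType d) (f : T -> cplx R) :
  measurable_fun setT (fun t => complex.Re (f t)) ->
  measurable_fun setT (fun t => complex.Im (f t)) ->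
  measurable_fun setT (f : T -> borelType (cplx R)).
Proof.
move=> mr mi; apply: borel_measurable_fun => U oU.
pose sq (q : rat * rat * nat) := [set z : cplx R |
  `|complex.Re z - ratr q.1.1| < q.2.+1%:R^-1 /\
  `|complex.Im z - ratr q.1.2| < q.2.+1%:R^-1].
have -> : f @^-1` U = \bigcup_(q : rat * rat * nat)
    (if `[< sq q `<=` U >] then f @^-1` sq q else set0).
  apply/seteqP; split=> [t Ut|t [q _]]; last first.
    by case: asboolP => // h; apply: h.
  have : nbhs (f t) U by apply: open_nbhs_nbhs.
  move=> /nbhs_cplxP[e e0 he].
  (* A radius below e / 2 leaves room for the distance from f t to the rational centre and for that
     from the centre to w. *)
  have [N _ hN] := near_infty_natSinv_lt (PosNum (divr_gt0 e0 (ltr0n R 2))).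
  have {}hN := hN N (leqnn N); rewrite /= in hN.
  have : 0 < (N.+1%:R^-1 : R) by rewrite invr_gt0.
  move: hN; set i : R := N.+1%:R^-1 => hN N0.
  have [q1] := @rat_in_itvoo R (complex.Re (f t) - i) (complex.Re (f t) + i)
    ltac:(by lra).
  have [q2] := @rat_in_itvoo R (complex.Im (f t) - i) (complex.Im (f t) + i)
    ltac:(by lra).
  rewrite !in_itv /= => /andP[a1 a2] /andP[b1 b2].
  exists (q1, q2, N) => //.
  have ft : sq (q1, q2, N) (f t).
    by split; rewrite /= -/i ltr_distlC; apply/andP; split; lra.
  case: asboolP => // -[] w [/=]; rewrite -/i !ltr_distl.
  move=> /andP[c1 c2] /andP[d1 d2].
  by apply: he; rewrite ltr_distl; apply/andP; split; lra.
apply: countable_bigcupT_measurable => [|q]; first exact: countableP.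
case: ifP => // _; rewrite /sq preimage_setI.
have mball (g : T -> R) (c r : R) : measurable_fun setT g ->
    measurable [set t | `|g t - c| < r].
  move=> mg; rewrite -[X in measurable X]setTI.
  have : measurable_fun setT (fun t => `|g t - c|).
    apply: measurableT_comp => //; apply: measurable_funB => //.
  move=> /(_ measurableT `]-oo, r[%classic); rewrite (_ : _ @^-1` _ = 
    [set t | `|g t - c| < r]); first by apply; exact: measurable_itv.
  by apply/seteqP; split=> x /=; rewrite in_itv.
by apply: measurableI; exact: mball.
Qed.

Lemma measurable_cplxM d (T : measurableType d) (f g : T -> borelType (cplx R)) :
  measurable_fun setT f -> measurable_fun setT g ->
  measurable_fun setT (fun t => (f t : cplx R) * g t : borelType (cplx R)).
Proof.
move=> mf mg.
have mfr := measurableT_comp measurable_Re mf.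
have mfi := measurableT_comp measurable_Im mf.
have mgr := measurableT_comp measurable_Re mg.
have mgi := measurableT_comp measurable_Im mg.
apply: measurable_cplx.
- under eq_fun do rewrite ReM.
    apply: measurable_funB; apply: measurable_funM; [exact: mfr|exact: mgr|
    exact: mfi|exact: mgi].
- under eq_fun do rewrite ImM.
  apply: measurable_funD; apply: measurable_funM; [exact: mfr|exact: mgi|
    exact: mfi|exact: mgr].
Qed.

Lemma measurable_circle_val : measurable_fun setT
  (@circle_val R : borelType (circle R) -> borelType (cplx R)).
Proof.
apply: borel_measurable_fun => U oU.
by apply: sub_sigma_algebra; exists U.
Qed.

Lemma measurable_circle d (T : measurableType d) (f : T -> circle R) :
  measurable_fun setT (fun t => circle_val (f t) : borelType (cplx R)) ->
  measurable_fun setT (f : T -> borelType (circle R)).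
Proof.
move=> mf; apply: borel_measurable_fun => _ [U oU <-].
rewrite -[X in measurable X]setTI; apply: mf => //.
exact: sub_sigma_algebra.
Qed.

Lemma measurable_circleM d (T : measurableType d)
    (f g : T -> borelType (circle R)) :
  measurable_fun setT f -> measurable_fun setT g ->
  measurable_fun setT (fun t => (f t * g t)%g : borelType (circle R)).
Proof.
move=> mf mg; apply: measurable_circle; apply: measurable_cplxM.
  exact: (measurableT_comp measurable_circle_val mf).
exact: (measurableT_comp measurable_circle_val mg).
Qed.

End ComplexTopology.

(** * Lebesgue measure on the circle *)

Section CircleAverage.
Variable R : realType.
Local Notation bC := (borelType (circle R)).
Local Notation lam := (@lebesgue_measure R).

Lemma cis_subproof (t : R) : `|(cos t +i* sin t : cplx R)| == 1.
Proof. by rewrite normc_def /= cos2Dsin2 sqrtr1. Qed.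

(** The parametrization t |-> e^{it}: Lebesgue measure on [0, 2 pi) then plays the role of a Haar
    measure of the circle, of total mass 2 pi. *)
Definition cis (t : R) : circle R := exist _ (cos t +i* sin t) (cis_subproof t).

Lemma cisD s t : cis (s + t) = (cis s * cis t)%g.
Proof.
apply: circle_valI; rewrite circle_valM /circle_val /=; apply/eqP.
by rewrite eq_complex /= cosD sinD addrC eqxx [X in _ == X]addrC mulrC eqxx.
Qed.

Lemma cis2pi t : cis (pi *+ 2 + t) = cis t.
Proof.
apply: circle_valI; rewrite /circle_val /=.
by rewrite addrC cosD2pi sinD2pi.
Qed.

Lemma cis_surj (a : circle R) : exists2 t : R, 0 <= t < pi *+ 2 & cis t = a.
Proof.
have pi0 := @pi_gt0 R.
case: a => -[x y] a1; have := eqP a1; rewrite normc_def /= => -[].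
move=> /(congr1 (fun z => z ^+ 2)); rewrite sqr_sqrtr ?addr_ge0 ?sqr_ge0//.
rewrite expr1n => xy1.
have x1 : -1 <= x <= 1.
  by rewrite -ler_norml -(@ler_pXn2r _ 2)// ?nnegrE// real_normK ?num_real//
    expr1n -xy1 lerDl sqr_ge0.
have xin : x \in `[(-1), 1] by rewrite in_itv.
have siny : sin (acos x) = `|y|.
  rewrite sin_acos// -sqrtr_sqr; congr Num.sqrt.
  by rewrite -xy1 addrC addKr.
have [y0|y0] := leP 0 y.
  exists (acos x).
    rewrite acos_ge0//= (le_lt_trans (acos_lepi x1))//.
    by rewrite mulr2n ltrDl.
  apply: circle_valI; rewrite /circle_val /= acosK// siny ger0_norm//.
(* x = 1 would force y = 0; strict positivity puts 2 pi - acos x below 2 pi. *)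
have acos_pos : 0 < acos x.
  rewrite acos_gt0// lt_neqAle (andP x1).1 (andP x1).2 !andbT /=.
  apply/eqP => xE; move: xy1; rewrite xE expr1n => /eqP.
  by rewrite -subr_eq0 [1 + _]addrC addrK sqrf_eq0 lt_eqF.
exists (pi *+ 2 - acos x).
  rewrite subr_ge0 gtrBl acos_pos andbT (le_trans (acos_lepi x1))//.
  by rewrite mulr2n lerDl ltW.
rewrite cis2pi; apply: circle_valI; rewrite /circle_val /=.
by rewrite cosN sinN acosK// siny ltr0_norm// opprK.
Qed.

Lemma measurable_cis : measurable_fun setT (cis : R -> bC).
Proof.
apply: measurable_circle; apply: measurable_cplx => /=.
  by apply: continuous_measurable_fun; exact: continuous_cos.
by apply: continuous_measurable_fun; exact: continuous_sin.
Qed.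

(** Uniqueness of Lebesgue measure: the translated measure has the right value on the intervals ]a,
    b]. *)
Lemma lebesgue_measure_shift (c : R) (A : set R) : measurable A ->
  lam ((fun x => c + x) @^-1` A) = lam A.
Proof.
move=> mA.
have mf : measurable_fun [set: R] (fun x : R => c + x).
  by apply: measurable_funD => //; exact: measurable_cst.
apply/esym/(@lebesgue_measure_unique R
  (pushforward lam ((fun x => c + x) : _ -> measurableTypeR R))) => //= _ [[a b]] _ <-.
rewrite /pushforward (_ : _ @^-1` _ = `]a - c, b - c]%classic).
  rewrite !lebesgue_measure_itv/= !lte_fin ltrD2r.
  by case: ifP => // _; rewrite -!EFinB; congr EFin; ring.
by apply/seteqP; split=> x /=; rewrite !in_itv /= ltrBlDl lerBrDl.
Qed.

(** With b = cis c, rotation becomes the shift of [0, 2 pi) to [c, c + 2 pi); the overhang [2 pi, c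
    + 2 pi) is carried back to [0, c) by periodicity. *)
Lemma lebesgue_measure_rotation (b : circle R) (A : set (circle R)) :
  measurable (A : set bC) ->
  lam (`[0, pi *+ 2[ `&` cis @^-1` ((fun a => (b * a)%g) @^-1` A)) =
  lam (`[0, pi *+ 2[ `&` cis @^-1` A).
Proof.
move=> mA; have [c /andP[c0 c2pi] <-] := cis_surj b.
have mP : measurable (cis @^-1` A).
  by rewrite -[X in measurable X]setTI; exact: measurable_cis.
have mI (x y : R) : measurable (`[x, y[ `&` cis @^-1` A).
  by apply: measurableI => //; exact: measurable_itv.
have split3 (x y z : R) : x <= y <= z ->
    lam (`[x, z[ `&` cis @^-1` A) =
    (lam (`[x, y[ `&` cis @^-1` A) + lam (`[y, z[ `&` cis @^-1` A))%E.
  move=> /andP[xy yz]; rewrite -measureU; [|exact: mI|exact: mI|].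
    congr (lam _); rewrite -setIUl; congr (_ `&` _).
    apply/seteqP; split=> t /=; rewrite !in_itv /=.
      by move=> /andP[h1 h2]; have [h|h] := ltP t y; [left|right]; apply/andP; split.
    by move=> [|] /andP[h1 h2]; apply/andP; split; lra.
  apply/seteqP; split=> t //= [[h1 _] [h2 _]]; move: h1 h2.
  by rewrite !in_itv /= => /andP[_ h1] /andP[h2 _]; lra.
transitivity (lam (`[c, c + pi *+ 2[ `&` cis @^-1` A)).
  rewrite -[RHS](lebesgue_measure_shift c)//; congr (lam _).
  apply/seteqP; split=> t /=; rewrite !in_itv /= cisD => -[/andP[h1 h2] h3];
    by split => //; apply/andP; split; lra.
rewrite (split3 _ (pi *+ 2)); last by apply/andP; split; lra.
rewrite [RHS](split3 _ c) ?c0 ?ltW//= addeC; congr (_ + _)%E.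
rewrite -[LHS](lebesgue_measure_shift (pi *+ 2))//; congr (lam _).
apply/seteqP; split=> t /=; rewrite !in_itv /= cis2pi => -[/andP[h1 h2] h3];
  by split => //; apply/andP; split; lra.
Qed.

End CircleAverage.

(** * The Haar measure of the extension *)

Lemma circle_mulgC (R : realType) (a b : circle R) : (a * b = b * a)%g.
Proof. exact: circle_mulC. Qed.

Section TwistedHaar.
Variables (R : realType) (G : preTopGroupType).
Hypothesis hG : lcsc_group G.
Variables (muG : {measure set (borelType G) -> \bar R}) (DeltaG : G -> R).
Hypotheses (hmuG : left_haar muG) (hDeltaG : modular_function muG DeltaG).
Variables (omega : borel_cocycle R G) (tau : topology_on (circle R * G)).
Hypothesis htau : twisted_topology omega tau.
Local Notation E := (twisted omega tau).
Local Notation bG := (borelType G).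
Local Notation bC := (borelType (circle R)).
Local Notation bE := (borelType E).
Local Notation lam := (@lebesgue_measure R).

Lemma twisted_measurableE (A : set E) :
  measurable (A : set bE) = measurable (A : set (bC * bG)%type).
Proof. by have [_ ->] := htau. Qed.

Lemma measurable_fun_twisted d (T : measurableType d) (f : E -> T) :
  measurable_fun setT (f : (bC * bG)%type -> T) ->
  measurable_fun setT (f : bE -> T).
Proof.
by move=> mf _ A mA; rewrite twisted_measurableE; exact: mf.
Qed.

Lemma measurable_twisted_fst : measurable_fun setT (fst : bE -> bC).
Proof. by apply: measurable_fun_twisted; exact: measurable_fst. Qed.

Lemma measurable_twisted_snd : measurable_fun setT (snd : bE -> bG).
Proof. by apply: measurable_fun_twisted; exact: measurable_snd. Qed.

(* As omega is not normalized, this, and not (a, 1), is the central element that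
   multiplies the first coordinate by a. *)
Definition tw_circle (a : circle R) : E := (a * (omega 1 1)^-1, 1)%g.

Lemma tw_circleM a (x : E) : (tw_circle a * x)%g = (a * x.1, x.2)%g.
Proof.
case: x => b s; rewrite -[LHS]/(tw_mul _ _) /tw_mul /= mul1g cocycle1l; congr pair.
apply: circle_valI; rewrite !(circle_valM, circle_valV).
by field; exact: circle_val_neq0.
Qed.

Variable muE : {measure set bE -> \bar R}.
Hypothesis hmuE : left_haar muE.

Let lcE : lcsc_group E. Proof. by have [] := htau. Qed.

(** For [W] compact of positive measure, the average [h], read on E, has integral 2 pi muE(W), which
    is positive and finite. The sets h >= 1/(n+1) therefore have finite measure by Markov's
    inequality, and one of them has positive measure. *)
Lemma twisted_finite_pos : exists2 B : set G, measurable (B : set bG) &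
  (0 < muE (snd @^-1` B) < +oo)%E.
Proof.
have [W [cW W0]] := left_haar_compact_pos lcE hmuE.
have [_ /(_ _ cW) Woo _] := hmuE.
have [_ _ sepE _ _] := lcE.
have mWE : measurable (W : set bE) by exact: compact_borel.
have mW : measurable (W : set (bC * bG)%type) by rewrite -twisted_measurableE.
pose I : set R := `[0, pi *+ 2[%classic.
have mI : measurable I by exact: measurable_itv.
have lamI : lam I = (pi *+ 2)%:E.
  rewrite lebesgue_measure_itv/= lte_fin mulr2n addr_gt0 ?pi_gt0//.
  by rewrite -EFinB subr0.
have pi0 := @pi_gt0 R.
pose S := [set z : E * R | I z.2 /\ W (cis z.2 * z.1.1, z.1.2)%g].
have mfst : measurable_fun setT (fun z : bE * R => z.1.1 : bC).
  exact: (measurableT_comp measurable_twisted_fst measurable_fst).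
have msnd : measurable_fun setT (fun z : bE * R => z.1.2 : bG).
  exact: (measurableT_comp measurable_twisted_snd measurable_fst).
have mS : measurable (S : set (bE * R)).
  apply: measurableI.
    exact: (measurable_preimageT (f := fun z : bE * R => z.2) measurable_snd).
  apply: (measurable_preimageT (T' := (bC * bG)%type)
    (f := fun z : bE * R => (cis z.2 * z.1.1, z.1.2)%g)) => //.
  apply: measurable_fun_pair => //; apply: measurable_circleM => //.
  exact: (measurableT_comp (@measurable_cis R) measurable_snd).
(* The slice of [S] at circle coordinate 1, which lives over G alone. *)
pose S0 := [set z : G * R | I z.2 /\ W (cis z.2, z.1)].
have mS0 : measurable (S0 : set (bG * R)).
  apply: measurableI.
    exact: (measurable_preimageT (f := fun z : bG * R => z.2) measurable_snd).
  apply: (measurable_preimageT (T' := (bC * bG)%type)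
    (f := fun z : bG * R => (cis z.2, z.1))) => //.
  apply: measurable_fun_pair; last exact: measurable_fst.
  exact: (measurableT_comp (@measurable_cis R) measurable_snd).
pose h := (lam \o xsection S0).
have lam_sf : sigma_finite [set: measurableTypeR R] lam.
  exact: sigma_finiteT.
have mh : measurable_fun [set: bG] h.
  exact: (sigma_finite_measurable_xsection lam_sf mS0).
have muE_sf := left_haar_sigma_finite lcE hmuE.
(* Rotation invariance makes the average of \1_W over the fibres of E -> G
   depend on the point of G only. *)
have hE x : lam (xsection S x) = h x.2.
  rewrite /h /=; transitivity (lam (I `&`
      @cis R @^-1` ((fun a => (x.1 * a)%g) @^-1` (ysection W x.2)))).
    congr (lam _); apply/seteqP; split=> t; rewrite /xsection /ysection /=;
      by rewrite !inE /S /= circle_mulgC.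
  rewrite lebesgue_measure_rotation; last exact: (@measurable_ysection _ _ bC bG).
  by congr (lam _); apply/seteqP; split=> t; rewrite /xsection /ysection /= !inE.
have Wfin : muE W = (fine (muE W))%:E by rewrite fineK// ge0_fin_numE.
have inth : (\int[muE]_x h x.2 = muE W * (pi *+ 2)%:E)%E.
  under eq_integral do rewrite -hE.
  rewrite (sigma_finite_tonelli_section muE_sf lam_sf mS).
  transitivity (\int[lam]_(t in I) muE W)%E; last first.
    by rewrite integral_cst//; congr (_ * _)%E; exact: lamI.
  rewrite [RHS]integral_mkcond; apply: eq_integral => t _.
  rewrite patchE; case: ifPn => [It|nIt].
    (* The slice at t is the preimage of [W] under translation by the central element belonging to
       cis t, so invariance gives it the measure of [W]. *)
    rewrite -[RHS](left_haar_preimage hmuE (tw_circle (cis t)))//; congr (muE _).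
    apply/seteqP; split=> x; rewrite /ysection /= inE /S /= tw_circleM.
      by case.
    by split => //; rewrite inE in It.
  rewrite (_ : ysection S t = set0) ?measure0//.
  apply/seteqP; split=> x //; rewrite /ysection /= inE /S /= => -[It _].
  by move: nIt; rewrite notin_setE.
have h0 s : (0 <= h s)%E by exact: measure_ge0.
pose B n := [set s | (n.+1%:R^-1%:E <= h s)%E].
have mB n : measurable (B n : set bG).
  rewrite -[X in measurable X]setTI.
  exact: emeasurable_fun_c_infty.
have mhE : measurable_fun [set: bE] (fun x => h x.2).
  exact: (measurableT_comp mh measurable_twisted_snd).
have mBE n : measurable (snd @^-1` B n : set bE).
  exact: measurable_preimageT measurable_twisted_snd (mB n).
have Boo n : (muE (snd @^-1` B n) < +oo)%E.
  have : (n.+1%:R^-1%:E * muE (snd @^-1` B n) <= muE W * (pi *+ 2)%:E)%E.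
    rewrite -inth -integral_cst//.
    apply: (@le_trans _ _ (\int[muE]_(x in snd @^-1` B n) h x.2)%E).
      apply: ge0_le_integral => //.
        by move=> x _; rewrite lee_fin invr_ge0.
      exact: measurable_funTS.
    by apply: ge0_subset_integral => //; exact: mBE.
  rewrite Wfin -EFinM ltey; apply: contraTneq => ->.
  by rewrite gt0_muley ?lte_fin ?invr_gt0.
(* Otherwise h, positive only on the union of the [B n], vanishes almost everywhere on E, against
   its positive integral. *)
have [n Bn] : exists n, (0 < muE (snd @^-1` B n))%E.
  apply: contrapT => /forallNP hn.
  have : (muE W * (pi *+ 2)%:E = 0)%E.
    rewrite -inth -[RHS](integral0 muE setT); apply: ge0_ae_eq_integral => //.
    exists (\bigcup_n (snd @^-1` B n)); split.
    - exact: bigcupT_measurable.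
    - apply/eqP; rewrite eq_le measure_ge0 andbT.
      apply: (le_trans (generalized_Boole_inequality _ _ _)) => //.
        exact: bigcupT_measurable.
      rewrite eseries0// => n _ _; apply/eqP; rewrite eq_le measure_ge0 andbT.
      by rewrite leNgt; apply/negP/hn.
    - move=> x /= hx; apply: contrapT => nB; apply: hx => _.
      apply/eqP; rewrite eq_le h0 andbT; apply/lee_addgt0Pr => e e0.
      have [n _ hn'] := near_infty_natSinv_lt (PosNum e0).
      rewrite add0e leNgt; apply/negP => eh; apply: nB; exists n => //=.
      by rewrite /B /= (le_trans _ (ltW eh))// lee_fin ltW// hn' /=.
  move=> /eqP; rewrite mule_eq0; rewrite gt_eqF//= eqe gt_eqF//.
  by rewrite mulr2n addr_gt0.
by exists (B n) => //; rewrite Bn Boo.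
Qed.

(** [snd] is a homomorphism, so translation of G by s is covered by translation of E by the lift (1,
    s). *)
Lemma haar_twisted : exists2 k : R, 0 < k &
  forall B : set G, measurable (B : set bG) ->
    muE (snd @^-1` B) = (k%:E * muG B)%E.
Proof.
have [B mB Bpos] := twisted_finite_pos.
apply: (haar_comparison hG hmuG hDeltaG (left_haar_sigma_finite lcE hmuE)
  measurable_twisted_snd _ mB Bpos) => s A mA.
rewrite -[RHS](left_haar_preimage hmuE ((1%g, s) : E))//.
exact: measurable_preimageT measurable_twisted_snd mA.
Qed.

(** Right translation by x maps the preimage of B onto the preimage of B x.2. For B of finite
    positive measure both modular functions scale the same number, which cancels. *)
Lemma modular_twisted (DeltaE : E -> R) : modular_function muE DeltaE ->
  forall x, DeltaE x = DeltaG x.2.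
Proof.
move=> [_ hDE] x; have [k k0 hk] := haar_twisted.
have [B mB /andP[B0 Boo]] := twisted_finite_pos.
have mBE : measurable (snd @^-1` B : set bE).
  exact: measurable_preimageT measurable_twisted_snd mB.
have := hDE x _ mBE.
have -> : [set (y * x)%g | y in (snd @^-1` B : set E)] =
    snd @^-1` [set (s * x.2)%g | s in B].
  apply/seteqP; split=> [_ [y By <-]|z /= [s Bs sz]]; first by exists y.2.
  exists (z * x^-1)%g; last by rewrite mulgVK.
  by change (B (z.2 * x.2^-1)%g); rewrite -sz mulgK.
have mB' : measurable ([set (s * x.2)%g | s in B] : set bG).
  have := rmul_preimage x.2^-1%g B; rewrite invgK => <-.
  apply: (measurable_preimageT (T' := borelType G)) => //.
  exact: measurable_fun_mulg.
have [_ hDG] := hDeltaG.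
rewrite hk// hDG// muleCA -hk//.
have -> : muE (snd @^-1` B) = (fine (muE (snd @^-1` B)))%:E.
  by rewrite fineK// ge0_fin_numE.
move: B0; case: (muE _) Boo => //= r _ r0 [] /mulIf -> //.
by rewrite gt_eqF.
Qed.

Lemma integral_twisted : exists2 k : R, 0 < k & forall f : G -> \bar R,
  measurable_fun [set: bG] f -> (forall s, 0 <= f s)%E ->
  (\int[muE]_x f x.2 = k%:E * \int[muG]_s f s)%E.
Proof.
have [k k0 hk] := haar_twisted; exists k => // f mf f0.
rewrite -(@ge0_integral_mscale _ _ _ muG _ measurableT (NngNum (ltW k0)))//.
rewrite -[LHS](@ge0_integral_pushforward _ _ _ _ _ _ measurable_twisted_snd
  muE setT f)//.
apply: eq_measure_integral => [|mf2 A mA _]; first exact: measurable_twisted_snd.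
exact: hk.
Qed.

Lemma ae_twisted (Z : set G) : measurable (Z : set bG) ->
  {ae muE, forall x, Z x.2} <-> {ae muG, forall s, Z s}.
Proof.
move=> mZ; have [k k0 hk] := haar_twisted.
have mCZ : measurable (~` Z : set bG) by exact: measurableC.
have mCE : measurable (snd @^-1` (~` Z) : set bE).
  exact: measurable_preimageT measurable_twisted_snd mCZ.
change (muE.-negligible (snd @^-1` (~` Z)) <-> muG.-negligible (~` Z)).
split=> [/(measure_negligible mCE)|/(measure_negligible mCZ)] Z0;
  apply/negligibleP => //.
  have /eqP := etrans (esym (hk _ mCZ)) Z0.
  by rewrite mule_eq0 eqe gt_eqF//= => /eqP.
by apply: (etrans (hk _ mCZ)); rewrite Z0 mule0.
Qed.

Variables (H : hilbert R) (pi : G -> H -> H).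
Hypothesis mpi : forall xi eta, measurable_fun [set: bG]
  ((fun s => hdot H (pi s xi) eta) : bG -> borelType (cplx R)).

Lemma rep_twisted_coefficient (x : E) xi eta :
  hdot H (rep_twisted omega tau pi x xi) eta =
  circle_val x.1 * hdot H (pi x.2 xi) eta.
Proof. by rewrite /rep_twisted linearZl_LR. Qed.

Lemma measurable_rep_twisted xi eta : measurable_fun [set: bE]
  ((fun x => hdot H (rep_twisted omega tau pi x xi) eta) :
     bE -> borelType (cplx R)).
Proof.
rewrite (_ : (fun x => _) = (fun x : E =>
  circle_val x.1 * hdot H (pi x.2 xi) eta)); last first.
  by apply/funext => x; exact: rep_twisted_coefficient.
apply: measurable_cplxM.
  exact: (measurableT_comp (@measurable_circle_val R) measurable_twisted_fst).
exact: (measurableT_comp (mpi xi eta) measurable_twisted_snd).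
Qed.

(** The coefficient at (a, s) is a times the coefficient at s: same modulus, same zeros. The factor
    k is finite and positive, so it changes neither finiteness of the integral nor null sets. *)
Lemma square_integrable_twisted :
  square_integrable muE (rep_twisted omega tau pi) <->
  square_integrable muG pi.
Proof.
have [k k0 hk] := integral_twisted.
suff h xi eta :
    ((\int[muE]_x ((complex.Re
        `|hdot H (rep_twisted omega tau pi x xi) eta|) ^+ 2)%:E < +oo)%E <->
     (\int[muG]_s ((complex.Re `|hdot H (pi s xi) eta|) ^+ 2)%:E < +oo)%E) /\
    ({ae muE, forall x, hdot H (rep_twisted omega tau pi x xi) eta = 0} <->
     {ae muG, forall s, hdot H (pi s xi) eta = 0}).
  by split=> -[xi [eta [h1 h2]]]; exists xi, eta;
    have [[i1 i2] [j1 j2]] := h xi eta; split; auto.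
split.
  have -> : (\int[muE]_x ((complex.Re
        `|hdot H (rep_twisted omega tau pi x xi) eta|) ^+ 2)%:E =
     \int[muE]_x ((complex.Re `|hdot H (pi x.2 xi) eta|) ^+ 2)%:E)%E.
    apply: eq_integral => x _; rewrite rep_twisted_coefficient normrM.
    by have /eqP -> := svalP x.1; rewrite mul1r.
  rewrite (hk (fun s => ((complex.Re `|hdot H (pi s xi) eta|) ^+ 2)%:E)).
  - split=> [|h]; last by apply: lte_mul_pinfty => //; rewrite lee_fin ltW.
    by rewrite !ltey; apply: contraNneq => ->; rewrite gt0_muley ?lte_fin.
  - apply/measurable_EFinP; rewrite (_ : (fun s => _) = (fun s =>
      (complex.Re (hdot H (pi s xi) eta)) ^+ 2 +
      (complex.Im (hdot H (pi s xi) eta)) ^+ 2)); last first.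
      apply/funext => s; rewrite normc_def /=.
      by rewrite sqr_sqrtr ?addr_ge0 ?sqr_ge0.
    apply: measurable_funD; apply: measurable_funX.
      exact: (measurableT_comp (@measurable_Re R) (mpi xi eta)).
    exact: (measurableT_comp (@measurable_Im R) (mpi xi eta)).
  - by move=> s; rewrite lee_fin sqr_ge0.
have mZ : measurable ([set s | hdot H (pi s xi) eta = 0] : set bG).
  rewrite (_ : [set s | _] =
    (fun s => complex.Re (hdot H (pi s xi) eta)) @^-1` [set 0] `&`
    (fun s => complex.Im (hdot H (pi s xi) eta)) @^-1` [set 0]).
    apply: measurableI; apply: measurable_preimageT => //.
      exact: (measurableT_comp (@measurable_Re R) (mpi xi eta)).
    exact: (measurableT_comp (@measurable_Im R) (mpi xi eta)).
  apply/seteqP; split=> s /= => [->//|[re im]].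
  by apply/eqP; rewrite eq_complex re im !eqxx.
have e : [set x : E | hdot H (rep_twisted omega tau pi x xi) eta = 0] =
    [set x : E | hdot H (pi x.2 xi) eta = 0].
  apply/seteqP; split=> x /=; rewrite rep_twisted_coefficient.
    by move=> /eqP; rewrite mulf_eq0 (negPf (circle_val_neq0 _)) => /eqP.
  by move=> ->; rewrite mulr0.
change (muE.-negligible (~` [set x : E |
  hdot H (rep_twisted omega tau pi x xi) eta = 0]) <->
  {ae muG, forall s, hdot H (pi s xi) eta = 0}).
by rewrite e; exact: ae_twisted.
Qed.

End TwistedHaar.

(** * Continuity of translation *)

Section TranslationContinuity.
Variables (R : realType) (G : preTopGroupType).
Hypothesis hG : lcsc_group G.
Local Notation bG := (borelType G).
Variable mu : {measure set bG -> \bar R}.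
Hypothesis hmu : left_haar mu.

Lemma lmul_continuous (g : G) : continuous (fun t : G => (g * t)%g).
Proof.
have [cM _ _ _ _] := hG => t.
apply: (@continuous_comp _ _ _ (fun t : G => (g, t))
  (fun p : G * G => (p.1 * p.2)%g)); last exact: cM.
by apply: cvg_pair => //; exact: cvg_cst.
Qed.

Lemma rmul_continuous (g : G) : continuous (fun t : G => (t * g)%g).
Proof.
have [cM _ _ _ _] := hG => t.
apply: (@continuous_comp _ _ _ (fun t : G => (t, g))
  (fun p : G * G => (p.1 * p.2)%g)); last exact: cM.
by apply: cvg_pair => //; exact: cvg_cst.
Qed.

Lemma nbhs1_lmul (g : G) (A : set G) :
  nbhs g A -> \forall t \near (1%g : G), A (t * g)%g.
Proof.
move=> Ag; have := @rmul_continuous g 1%g.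
by rewrite /continuous_at mul1g => /(_ _ Ag).
Qed.

Lemma nbhs1_inv (A : set G) :
  nbhs (1%g : G) A -> \forall t \near (1%g : G), A (t^-1)%g.
Proof.
have [_ cV _ _ _] := hG => A1.
by have := cV 1%g; rewrite /continuous_at invg1 => /(_ _ A1).
Qed.

Lemma compact_mulg (A B : set G) : compact A -> compact B ->
  compact [set (z.1 * z.2)%g | z in A `*` B].
Proof.
have [cM _ _ _ _] := hG => cA cB; apply: continuous_compact.
  exact: continuous_subspaceT.
exact: compact_setX.
Qed.

Lemma translate_compact (t : G) (K : set G) : compact K ->
  compact ((fun x => (t * x)%g) @^-1` K).
Proof.
move=> cK; rewrite lmul_preimage.
have -> : [set (t^-1 * x)%g | x in K] =
    [set (z.1 * z.2)%g | z in [set t^-1%g] `*` K].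
  apply/seteqP; split=> [_ [x Kx <-]|_ [[_ x] [/= -> Kx] <-]]; last by exists x.
  by exists (t^-1, x)%g.
by apply: compact_mulg => //; exact: compact_set1.
Qed.

(* W_n K decreases to K when (W_n) is a countable basis at 1, so mu(W_n K) tends
   to mu(K); no regularity of mu is needed. *)
Lemma translate_measure_small (K : set G) (e : R) : compact K -> 0 < e ->
  \forall t \near (1%g : G),
    (mu ((fun x => (t * x)%g) @^-1` K `\` K) < e%:E)%E.
Proof.
move=> cK e0; have [cM cV sep lc sc] := hG; have [_ muK _] := hmu.
have [V] := lc 1%g Logic.I; rewrite withinET => V1 [cptV clV].
have [b [bo hb]] := second_countable_seq sc.
(* The guard [b i 1] selects the basic sets around 1 among the first n + 1; [V] ensures finite
   measure from the start. *)
pose W n := [set w : G | V w /\ forall i, (i <= n)%N -> b i 1%g -> b i w].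
have W1 n : nbhs (1%g : G) (W n).
  apply: filterI => //; elim: n => [|n IH].
    have [b1|nb1] := pselect (b 0%N 1%g).
      have : nbhs (1%g : G) (b 0%N) by apply: open_nbhs_nbhs.
      by apply: filterS => w bw i; rewrite leqn0 => /eqP ->.
    by apply: nearW => w i; rewrite leqn0 => /eqP ->.
  have [b1|nb1] := pselect (b n.+1 1%g).
    have : nbhs (1%g : G) (b n.+1) by apply: open_nbhs_nbhs.
    apply: filterS2 IH => w h bw i; rewrite leq_eqVlt ltnS => /predU1P[->//|].
    exact: h.
  apply: filterS IH => w h i; rewrite leq_eqVlt ltnS => /predU1P[->//|].
  exact: h.
(* the open set W_n° K *)
pose U n := [set x : G | exists2 k, K k & (W n)° (x * k^-1)%g].
have mU n : measurable (U n : set bG).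
  apply: sub_sigma_algebra; rewrite openE => x [k Kk].
  rewrite -[_ (x * k^-1)%g]/(nbhs (x * k^-1)%g (W n)) => /nbhs_interior.
  move=> /(fun h => cM (x, k^-1)%g _ h) [[A B] [/= Ax Bk]] AB.
  apply: filterS Ax => y Ay; exists k => //.
  by apply: (AB (y, k^-1)%g); split => //=; exact: nbhs_singleton.
have U0 : (mu (U 0%N) < +oo)%E.
  apply: (le_lt_trans _ (muK _ (compact_mulg cptV cK))).
  apply: le_measure; rewrite ?inE//.
    by apply: compact_borel => //; exact: compact_mulg.
  move=> x [k Kk] /interior_subset [Vxk _]; exists (x * k^-1, k)%g => //=.
  by rewrite mulgVK.
have ndU : nonincreasing_seq U.
  move=> n m nm; apply/subsetPset => x [k Kk h]; exists k => //.
  apply: interiorS h => w [Vw h]; split => // i im; apply: h.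
  exact: leq_trans nm.
have KU : K = \bigcap_n U n.
  apply/seteqP; split=> [x Kx n _|x Ux].
    by exists x => //; rewrite mulgV; exact: W1.
  apply: contrapT => nKx.
  have : nbhs x (~` K).
    apply: open_nbhs_nbhs; split => //; apply: closed_openC.
    exact: compact_closed.
  (* For w near 1, w^-1 x stays outside K, whereas x in W_n K would provide such a w with w^-1 x in
     K. *)
  move=> /nbhs1_lmul/nbhs1_inv /hb[n [bn1 bn]].
  have [k Kk /interior_subset[_ /(_ n (leqnn n) bn1)/bn]] := Ux n Logic.I.
  by apply; rewrite invgM invgK mulgVK.
have mK : measurable (K : set bG) by exact: compact_borel.
have Kfin : mu K \is a fin_num by rewrite ge0_fin_numE// muK.
have cvU : mu \o U @ \oo --> mu K.
  by rewrite [X in _ --> mu X]KU; apply: nonincreasing_cvg_mu => //; rewrite -KU.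
have [n Un] : exists n, (mu (U n) < mu K + e%:E)%E.
  have : nbhs (mu K) [set y | (y < mu K + e%:E)%E].
    by apply: open_nbhs_nbhs; split; [exact: open_ereal_lt_ereal|
      rewrite /= lteDl// lte_fin].
  by move=> /cvU [n _ hn]; exists n; exact: (hn n (leqnn n)).
have := nbhs1_inv (nbhs_interior (W1 n)); apply: filterS => t Wt.
have mtK : measurable ((fun x => (t * x)%g) @^-1` K : set bG).
  by apply: compact_borel => //; exact: translate_compact.
apply: (@le_lt_trans _ _ (mu (U n `\` K))).
  apply: le_measure; rewrite ?inE; [exact: measurableD|exact: measurableD|].
  apply: setSD => x /= Ktx; exists (t * x)%g => //.
  by rewrite invgM mulgA mulgV mul1g.
have KsubU : K `<=` U n by rewrite [X in X `<=` _]KU; apply: bigcap_inf.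
rewrite measureD// ?setIidr//; last first.
  by rewrite (lt_trans Un)// lte_add_pinfty ?ltry// muK.
by rewrite lteBlDl.
Qed.

Lemma bounded_compact_integrable (f : G -> R) (M : R) (K : set G) :
  measurable_fun [set: bG] f -> (forall s, `|f s| <= M) -> compact K ->
  mu.-integrable K (EFin \o f).
Proof.
move=> mf fM cK; have [_ _ sep _ _] := hG; have [_ muK _] := hmu.
apply: measurable_bounded_integrable.
- exact: compact_borel.
- exact: muK.
- exact: measurable_funTS.
- exists M; split; first exact: num_real.
  by move=> x Mx s _ /=; exact: le_trans (fM s) (ltW Mx).
Qed.

Lemma Rintegral_bound (f : G -> R) (M : R) (D : set G) :
  measurable (D : set bG) -> (mu D < +oo)%E -> mu.-integrable D (EFin \o f) ->
  (forall s, `|f s| <= M) -> `|\int[mu]_(s in D) f s| <= M * fine (mu D).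
Proof.
move=> mD Doo intf fM; apply: (le_trans (le_normr_Rintegral mD intf)).
rewrite -(Rintegral_cst mu mD M); apply: le_Rintegral => //.
- exact: integrable_norm.
- by apply/integrableP; split; [exact: measurable_cst|
    rewrite /= integral_cst// lte_mul_pinfty// lee_fin].
Qed.

Lemma Rintegral_lmul (f : G -> R) (M : R) (K : set G) (t : G) :
  measurable_fun [set: bG] f -> (forall s, `|f s| <= M) -> compact K ->
  \int[mu]_(s in K) f (t * s)%g =
  \int[mu]_(s in (fun x => (t^-1 * x)%g) @^-1` K) f s.
Proof.
move=> mf fM cK; pose tK := (fun x => (t^-1 * x)%g) @^-1` K.
have [_ _ sep _ _] := hG.
have mtK : measurable (tK : set bG).
  by apply: compact_borel => //; exact: translate_compact.
have mt : measurable_fun [set: bG] ((fun x => (t * x)%g) : bG -> bG).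
  by apply: measurable_fun_mulg.
have KE : (fun x => (t * x)%g) @^-1` tK = K.
  by apply/seteqP; split=> x; rewrite /tK /= mulKg.
have mft : measurable_fun [set: bG] (fun s : bG => f (t * s)%g).
  exact: (measurableT_comp mf mt).
have iK : mu.-integrable ((fun x : bG => (t * x)%g : bG) @^-1` tK)
    ((EFin \o f) \o (fun x : bG => (t * x)%g : bG)).
  rewrite KE.
  by apply: (bounded_compact_integrable (f := fun s => f (t * s)%g) mft _ cK).
have mfE : measurable_fun [set: bG] (EFin \o f) by exact/measurable_EFinP.
have := integral_pushforward mt mfE iK mtK.
rewrite KE => h; rewrite /Rintegral; congr fine; rewrite -h.
apply: eq_measure_integral => A mA _.
exact: (left_haar_preimage hmu).
Qed.

(** Translation moves K to t K; the integrals over the common part cancel, and t K \ K and K \ t K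
    remain. Invariance turns the latter into t^-1 K \ K, so both errors have the form that is small
    for t near 1. *)
Lemma Rintegral_lmul_sub (f : G -> R) (M : R) (K : set G) (t : G) :
  measurable_fun [set: bG] f -> (forall s, `|f s| <= M) -> compact K ->
  `|\int[mu]_(s in K) f (t * s)%g - \int[mu]_(s in K) f s| <=
  M * (fine (mu ((fun x => (t^-1 * x)%g) @^-1` K `\` K)) +
       fine (mu ((fun x => (t * x)%g) @^-1` K `\` K))).
Proof.
move=> mf fM cK; rewrite (Rintegral_lmul t mf fM cK).
set A := _ @^-1` K; have [_ _ sep _ _] := hG; have [_ muK _] := hmu.
have cA : compact A by exact: translate_compact.
have mA : measurable (A : set bG) by exact: compact_borel.
have mK : measurable (K : set bG) by exact: compact_borel.
have iA := bounded_compact_integrable mf fM cA.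
have iK := bounded_compact_integrable mf fM cK.
have split_int (B C : set G) : measurable (B : set bG) ->
    measurable (C : set bG) -> mu.-integrable B (EFin \o f) ->
    \int[mu]_(s in B) f s =
    \int[mu]_(s in B `&` C) f s + \int[mu]_(s in B `\` C) f s.
  move=> mB mC iB; rewrite -Rintegral_setU.
  - by rewrite setUIDK.
  - exact: measurableI.
  - exact: measurableD.
  - by rewrite setUIDK.
  - by apply/disj_set2P; rewrite setDE setIACA setICr setI0.
rewrite (split_int A K)// (split_int K A)// (setIC K A) opprD addrACA subrr add0r.
have -> : mu ((fun x => (t * x)%g) @^-1` K `\` K) = mu (K `\` A).
  rewrite -[RHS](left_haar_preimage hmu t); last exact: measurableD.
  by congr (mu _); apply/seteqP; split=> x; rewrite /A /= mulKg.
have fin (B C : set G) : measurable (B : set bG) -> measurable (C : set bG) ->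
    compact B -> (mu (B `\` C) < +oo)%E.
  move=> mB mC cB; apply: (le_lt_trans _ (muK _ cB)).
  by apply: le_measure; rewrite ?inE//; exact: measurableD.
rewrite mulrDr (le_trans (ler_normB _ _))// lerD//.
  apply: Rintegral_bound => //; [exact: measurableD|exact: fin|].
  by apply: integrableS iA => //; exact: measurableD.
apply: Rintegral_bound => //; [exact: measurableD|exact: fin|].
by apply: integrableS iK => //; exact: measurableD.
Qed.

(** Adding M makes f a nonnegative density: the measures (f + M) mu and M mu agree on compact sets,
    which are stable under intersection and generate the Borel sets, hence agree everywhere. On each
    compact [K n] of a countable cover this forces f = 0 almost everywhere. *)
Lemma compact_integral_eq0 (f : G -> R) (M : R) :
  measurable_fun [set: bG] f -> (forall s, `|f s| <= M) ->
  (forall K, compact K -> \int[mu]_(s in K) f s = 0) ->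
  {ae mu, forall s, f s = 0}.
Proof.
move=> mf fM f0; have [_ _ sep lc sc] := hG; have [_ muK _] := hmu.
have [K [cK KT]] := sigma_compact lc sc.
have M0 : 0 <= M by apply: le_trans (fM 1%g).
pose g s := (f s + M)%:E.
have mg : measurable_fun [set: bG] g.
  by apply/measurable_EFinP; apply: measurable_funD => //; exact: measurable_cst.
have g0 s : (0 <= g s)%E.
  by rewrite lee_fin; have := fM s; rewrite ler_norml => /andP[]; lra.
pose m (h : G -> \bar R) (A : set bG) := (\int[mu]_(s in A) h s)%E.
have m0 h : m h set0 = 0%E by rewrite /m integral_set0.
have mge0 h : (forall s, 0 <= h s)%E -> forall A, (0 <= m h A)%E.
  by move=> h0 A; apply: integral_ge0.
have msa h : (forall s, 0 <= h s)%E -> measurable_fun [set: bG] h ->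
    semi_sigma_additive (m h).
  move=> h0 mh F mF tF mUF; rewrite /m ge0_integral_bigcup//; last first.
    exact: measurable_funTS.
  by apply: is_cvg_ereal_nneg_natsum_cond => n _ _; exact: integral_ge0.
pose m1 : {measure set bG -> \bar R} := HB.pack_for {measure set bG -> \bar R}
  (m g) (isMeasure.Build _ _ _ (m g) (m0 g) (mge0 g g0) (msa g g0 mg)).
pose c : G -> \bar R := fun=> M%:E.
have c0 s : (0 <= c s)%E by rewrite lee_fin.
have mc : measurable_fun [set: bG] c by exact: measurable_cst.
pose m2 : {measure set bG -> \bar R} := HB.pack_for {measure set bG -> \bar R}
  (m c) (isMeasure.Build _ _ _ (m c) (m0 c) (mge0 c c0) (msa c c0 mc)).
have mcE A : measurable (A : set bG) -> m c A = (M%:E * mu A)%E.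
  by move=> mA; rewrite /m integral_cst.
have mgE A B : measurable (A : set bG) -> compact B -> A `<=` B ->
    m g A = ((\int[mu]_(s in A) (f s)%:E) + m c A)%E /\ m c A \is a fin_num.
  move=> mA cB AB; have mB : measurable (B : set bG) by exact: compact_borel.
  have muA : (mu A < +oo)%E.
    by apply: (le_lt_trans _ (muK _ cB)); apply: le_measure; rewrite ?inE.
  split; last first.
    by rewrite mcE// fin_numM// ge0_fin_numE.
  rewrite /m /g integralD_EFin//.
    by apply: integrableS (bounded_compact_integrable mf fM cB).
  apply: integrableS (bounded_compact_integrable (f := cst M) (M := M) _ _ cB) => //.
  by move=> s; rewrite /= ger0_norm.
have key A : measurable (A : set bG) -> m1 A = m2 A.
  apply: (@measure_unique _ R bG (@compact G) K (borel_compact sep lc sc) _ cK KT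
    m1 m2) => //.
  - by move=> A1 A2 c1 c2; apply: compact_closedI => //; exact: compact_closed.
  - move=> B cB; have mB : measurable (B : set bG) by exact: compact_borel.
    change (m g B = m c B); have [-> _] := mgE B B mB cB (@subset_refl _ B).
    have fi := integrable_fin_num mB (bounded_compact_integrable mf fM cB).
    have := congr1 (@EFin R) (f0 B cB); rewrite /Rintegral fineK// => e0.
    by rewrite [X in (X + _)%E]e0 add0e.
  - move=> k; have mK : measurable (K k : set bG) by exact: compact_borel.
    change (m g (K k) < +oo)%E.
    have [e fin] := mgE (K k) (K k) mK (cK k) (@subset_refl _ _).
    have fi := integrable_fin_num mK (bounded_compact_integrable mf fM (cK k)).
    by rewrite -ge0_fin_numE ?mge0// e fin_numD fin andbT.
have aeK n : {ae mu, forall s, K n s -> (f s)%:E = 0%E}.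
  have mK : measurable (K n : set bG) by exact: compact_borel.
  apply: (@integral_ae_eq _ _ _ _ _ mK (cst 0%E) (EFin \o f)).
  - exact: bounded_compact_integrable.
  - exact: measurable_cst.
  move=> A AK mA; have [e fin] := mgE A (K n) mA (cK n) AK.
  rewrite integral0; have h : (_ = m c A)%E := etrans (esym e) (key A mA).
  have := congr1 (fun x => x - m c A)%E h.
  by rewrite /= addeK// subee.
have := ae_foralln aeK; apply: filterS => s hs.
have : setT s by [].
by rewrite -KT => -[n _ /hs []].
Qed.

End TranslationContinuity.

(** * Vectors with continuous orbit *)

Section BoundedOperators.
Variables (R : realType) (H : hilbert R).
Implicit Types (T U : H -> H).

Lemma rnormZc (c : cplx R) (x : H) :
  rnorm (c *: x) = complex.Re (`|c| : cplx R) * rnorm x.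
Proof.
rewrite /rnorm normrZ ReM (_ : complex.Im (`|c| : cplx R) = 0) ?mul0r ?subr0//.
Qed.

Lemma bounded_operator_bound T : bounded_operator T ->
  exists2 C : R, 0 <= C & forall x, rnorm (T x) <= C * rnorm x.
Proof.
move=> [lT cT].
pose L : {linear H -> H} := HB.pack T (GRing.isLinear.Build _ _ _ _ T lT).
have T0 : T 0 = 0 by exact: (linear0 L).
have : nbhs (T 0) [set y : H | rnorm (0 - y) < 1].
  by apply/nbhs_rnormP; exists 1 => // y; rewrite T0.
move=> /cT /nbhs_rnormP[d d0 hd].
exists (2 / d); first by rewrite divr_ge0// ltW.
move=> x; have [->|x0] := eqVneq x 0; first by rewrite T0 rnorm0 mulr0.
have nx0 := rnorm_gt0 x0.
pose a := d / (2 * rnorm x).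
have a0 : 0 < a by rewrite divr_gt0// mulr_gt0.
have /= := hd (a%:C *: x); rewrite !sub0r !rnormN rnormZ.
rewrite (_ : T (a%:C *: x) = a%:C *: T x); last exact: (linearZ_LR L).
rewrite rnormZ ger0_norm ?(ltW a0)// => h.
have /h : a * rnorm x < d.
  rewrite /a (_ : d / (2 * rnorm x) * rnorm x = d / 2); first lra.
  by field; rewrite gt_eqF.
rewrite mulrC -ltr_pdivlMr// /a => h'; apply: (le_trans (ltW h')).
rewrite le_eqVlt; apply/orP; left; apply/eqP.
by field; rewrite !gt_eqF.
Qed.

Lemma unitary_linear T : unitary T -> linear T. Proof. by case. Qed.

Lemma unitary_rdot T x y : unitary T -> rdot (T x) (T y) = rdot x y.
Proof. by case=> _ h _; rewrite /rdot h. Qed.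

Lemma unitary_rnorm T x : unitary T -> rnorm (T x) = rnorm x.
Proof.
move=> uT; have := unitary_rdot x x uT; rewrite !rdotxx => /eqP.
by rewrite eqrXn2 ?rnorm_ge0// => /eqP.
Qed.

Lemma bound_bounded_operator T (C : R) : linear T ->
  (forall x, rnorm (T x) <= C * rnorm x) -> bounded_operator T.
Proof.
move=> lT hC; split => // x A /nbhs_rnormP[e e0 he].
pose L : {linear H -> H} := HB.pack T (GRing.isLinear.Build _ _ _ _ T lT).
apply/nbhs_rnormP; exists (e / (`|C| + 1)).
  by rewrite divr_gt0// ltr_wpDl.
move=> y; rewrite ltr_pdivlMr ?ltr_wpDl// => h; apply: he.
have -> : T x - T y = T (x - y) by exact/esym/(linearB L).
apply: le_lt_trans (hC _) _; apply: le_lt_trans h.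
rewrite mulrC ler_wpM2l ?rnorm_ge0//.
by rewrite (le_trans (ler_norm C))// lerDl.
Qed.

End BoundedOperators.

(** * Continuous vectors of a weakly measurable unitary representation *)

Section WeaklyMeasurable.
Variables (R : realType) (G : preTopGroupType).
Hypothesis hG : lcsc_group G.
Local Notation bG := (borelType G).
Variable mu : {measure set bG -> \bar R}.
Hypothesis hmu : left_haar mu.
Variables (H : hilbert R) (sig : G -> H -> H).
Hypothesis sig_unitary : forall s, unitary (sig s).
Hypothesis sigM : forall s t x, sig s (sig t x) = sig (s * t)%g x.
Hypothesis sig_measurable : forall xi eta, measurable_fun [set: bG]
  ((fun s => hdot H (sig s xi) eta) : bG -> borelType (cplx R)).
Implicit Types x y z v w : H.

Let sigP s : linear (sig s). Proof. exact: unitary_linear. Qed.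

Let sigD s x y : sig s (x + y) = sig s x + sig s y.
Proof. by have := sigP s 1 x y; rewrite !scale1r. Qed.

Let sig0 s : sig s 0 = 0.
Proof. by have := sigD s 0 0; rewrite addr0 -[LHS]addr0 => /addrI. Qed.

Let sigZ s c x : sig s (c *: x) = c *: sig s x.
Proof. by have := sigP s c x 0; rewrite sig0 !addr0. Qed.

Let sigB s x y : sig s (x - y) = sig s x - sig s y.
Proof. by rewrite sigD -scaleN1r sigZ scaleN1r. Qed.

Let sig1 x : sig 1%g x = x.
Proof.
have [_ _ /(_ x)[y <-]] := sig_unitary 1%g.
by rewrite sigM mulg1.
Qed.

Let sigV s x y : rdot (sig s x) y = rdot x (sig s^-1%g y).
Proof.
by rewrite -[LHS](unitary_rdot _ _ (sig_unitary s^-1%g)) sigM mulVg sig1.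
Qed.

Let sig_rnorm s x : rnorm (sig s x) = rnorm x.
Proof. exact: unitary_rnorm. Qed.

Let mrdot x z : measurable_fun [set: bG] (fun s => rdot (sig s x) z).
Proof. exact: (measurableT_comp (@measurable_Re R) (sig_measurable x z)). Qed.

Let brdot x z s : `|rdot (sig s x) z| <= rnorm x * rnorm z.
Proof. by rewrite (le_trans (normr_rdot _ _))// sig_rnorm. Qed.

(** Only continuity at the identity is asked; isometry of [sig s] carries it to every point. *)
Definition continuous_vectors : set H :=
  [set x | forall e : R, 0 < e -> \forall t \near (1%g : G),
     rnorm (sig t x - x) < e].
Local Notation Hc := continuous_vectors.

Lemma continuous_vectorsP x : Hc x -> continuous (fun s => sig s x).
Proof.
move=> xc s A /nbhs_rnormP[e e0 he].
have := @lmul_continuous _ hG s^-1%g s; rewrite /continuous_at mulVg.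
move=> /(_ _ (xc e e0)) h; change (nbhs s [set t | A (sig t x)]).
apply: (filterS _ (h : nbhs s [set t | rnorm (sig (s^-1 * t)%g x - x) < e])).
move=> t ht; apply: he.
by rewrite rnormBC -(sig_rnorm s^-1%g) sigB !sigM mulVg sig1.
Qed.

Lemma continuous_vectors0 : Hc 0.
Proof. by move=> e e0; apply: nearW => t; rewrite sig0 subrr rnorm0. Qed.

Lemma continuous_vectorsD x y : Hc x -> Hc y -> Hc (x + y).
Proof.
move=> xc yc e e0; have e2 : 0 < e / 2 by rewrite divr_gt0.
apply: filterS2 (xc _ e2) (yc _ e2) => t h1 h2.
rewrite sigD opprD addrACA (le_lt_trans (rnormD _ _))//; lra.
Qed.

Lemma continuous_vectorsZ c x : Hc x -> Hc (c *: x).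
Proof.
move=> xc e e0; have [n n0] : exists2 n : R, 0 < n & complex.Re (`|c| : cplx R) < n.
  exists (`|complex.Re (`|c| : cplx R)| + 1); first by rewrite ltr_wpDl.
  by rewrite (le_lt_trans (ler_norm _))// ltrDl.
move=> cn; apply: filterS (xc _ (divr_gt0 e0 n0)) => t.
rewrite sigZ -scalerBr rnormZc ltr_pdivlMr// mulrC; apply: le_lt_trans.
by rewrite ler_wpM2r ?rnorm_ge0// ltW.
Qed.

Lemma continuous_vectors_closed : closed Hc.
Proof.
move=> x clx e e0; have e3 : 0 < e / 3 by rewrite divr_gt0.
have : nbhs x [set y | rnorm (x - y) < e / 3] by apply/nbhs_rnormP; exists (e / 3).
move=> /clx[y [yc /= xy]]; apply: filterS (yc _ e3) => t ht.
have -> : sig t x - x = sig t (x - y) + ((sig t y - y) + (y - x)).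
  by rewrite sigB !addrA !subrK.
rewrite (le_lt_trans (rnormD _ _))// sig_rnorm.
have := rnormD (sig t y - y) (y - x); rewrite (rnormBC y x); lra.
Qed.

(** sig t moves sig s x exactly as far as sig (s^-1 t s) moves x, and conjugation by s is continuous
    at 1. *)
Lemma continuous_vectors_sig s x : Hc x -> Hc (sig s x).
Proof.
move=> xc e e0.
have conj : (fun t : G => (s^-1 * t * s)%g) @ (1%g : G) --> (1%g : G).
  rewrite -[X in _ --> X](mulVg s) -{2}(mulg1 s^-1%g).
  apply: (@continuous_comp _ _ _ (fun t : G => (s^-1 * t)%g)
    (fun t => (t * s)%g)); [exact: lmul_continuous|exact: rmul_continuous].
have hc : nbhs (1%g : G) [set t | rnorm (sig (s^-1 * t * s)%g x - x) < e].
  exact: conj _ (xc e e0).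
apply: filterS hc => t /=.
by rewrite -(sig_rnorm s) sigB !sigM !mulgA mulgV mul1g.
Qed.

(** v is the weak integral of sig(s) x over K. For w = sig t v - v, |w|^2 is the change of int_K
    <sig(s) x, w> ds when s is replaced by t s, hence at most |x| |w| times the measure by which K
    and its translates differ. *)
Lemma weak_integral (K : set G) x : compact K ->
  exists2 v, Hc v & forall z, rdot v z = \int[mu]_(s in K) rdot (sig s x) z.
Proof.
move=> cK; have [_ _ sep _ _] := hG; have [_ muK _] := hmu.
have mK : measurable (K : set bG) by exact: compact_borel.
have int z : mu.-integrable K (EFin \o (fun s => rdot (sig s x) z)).
  exact: (bounded_compact_integrable hG hmu (mrdot x z) (brdot x z) cK).
pose L z := \int[mu]_(s in K) rdot (sig s x) z.
have [v _ hv] : exists2 v : H, [set: H] v & forall z, [set: H] z -> rdot v z = L z.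
  apply: (riesz_subspace (M := rnorm x * fine (mu K))) => //.
  - move=> y z; rewrite -RintegralD//; apply: eq_Rintegral => s _.
    by rewrite rdotDr.
  - move=> a z; rewrite -RintegralZl//; apply: eq_Rintegral => s _.
    by rewrite rdotZr.
  - move=> z; rewrite mulrAC.
    exact: (Rintegral_bound mK (muK _ cK) (int z) (brdot x z)).
exists v; last by move=> z; exact: hv.
(* Chosen so that 2 d |x| < e; the added 1 allows x = 0. *)
move=> e e0; pose d := e / (rnorm x + 1) / 2.
have nx1 : 0 < rnorm x + 1 by rewrite ltr_wpDl// rnorm_ge0.
have d0 : 0 < d by rewrite !divr_gt0.
have small := translate_measure_small hG hmu cK d0.
apply: filterS2 small (nbhs1_inv hG small) => t h1 h2.
set w := sig t v - v.
have fin (r : \bar R) : (0 <= r)%E -> (r < d%:E)%E -> fine r < d.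
  by case: r => //= r _; rewrite lte_fin.
have ww : rnorm w ^+ 2 <= rnorm x * rnorm w * (d + d).
  rewrite -rdotxx {1}/w rdotBl sigV !hv//.
  have -> : L (sig t^-1%g w) = \int[mu]_(s in K) rdot (sig (t * s)%g x) w.
    by apply: eq_Rintegral => s _; rewrite -sigV sigM.
  apply: (le_trans (ler_norm _)).
  apply: (le_trans (Rintegral_lmul_sub hG hmu t (mrdot x w) (brdot x w) cK)).
  by rewrite ler_wpM2l ?mulr_ge0 ?rnorm_ge0// lerD// ltW// fin.
have [w0|w0] := eqVneq (rnorm w) 0; first by rewrite w0.
have w_gt0 : 0 < rnorm w by rewrite lt_neqAle eq_sym w0 rnorm_ge0.
have : rnorm w <= rnorm x * (d + d).
  by rewrite -(ler_pM2l w_gt0) -expr2 (le_trans ww)// mulrCA mulrA.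
move=> /le_lt_trans; apply.
have -> : d + d = e / (rnorm x + 1) by rewrite /d; field; rewrite gt_eqF.
by rewrite mulrA ltr_pdivrMr// mulrC ltr_pM2l// ltrDl.
Qed.

(** v = int_K sig(s) x ds is a continuous vector, hence so is sig(s)^-1 v, and <sig(s) x, v> = 0 for
    all s. Thus |v|^2 = 0, and every integral of the coefficient over a compact set vanishes. *)
Lemma orthogonal_coefficient_ae x : (forall y, Hc y -> rdot x y = 0) ->
  forall z, {ae mu, forall s, rdot (sig s x) z = 0}.
Proof.
move=> xperp z.
apply: (compact_integral_eq0 hG hmu (mrdot x z) (brdot x z)) => K cK.
have [v vc hv] := weak_integral x cK.
suff v0 : v = 0 by rewrite -hv v0 rdot0l.
apply: rdotxx_eq0; rewrite hv -[RHS](Rintegral_set0 mu (fun=> 0)).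
rewrite Rintegral_set0 /Rintegral integral0_eq// => s _.
by rewrite sigV xperp//; exact: continuous_vectors_sig.
Qed.

Lemma continuous_projection x :
  exists2 p, Hc p & forall y, Hc y -> rdot p y = rdot x y.
Proof.
apply: (riesz_subspace (L := rdot x) (M := rnorm x)) => //.
- exact: continuous_vectors0.
- exact: continuous_vectorsD.
- by move=> a y; exact: continuous_vectorsZ.
- exact: continuous_vectors_closed.
- exact: rdotDr.
- by move=> a y; rewrite rdotZr.
- exact: normr_rdot.
Qed.

(** A countable dense set allows one point s at which the coefficients of u = x - p against all its
    members vanish together; then sig s u = 0. *)
Lemma continuous_vectors_separable : hseparable H -> forall x, Hc x.
Proof.
move=> [D cD dD] x; have [p pc hp] := continuous_projection x.
suff -> : x = p by [].
apply/eqP; rewrite -subr_eq0; apply/eqP; set u := x - p.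
have uperp y : Hc y -> rdot u y = 0 by move=> yc; rewrite rdotBl hp// subrr.
have aeu := orthogonal_coefficient_ae uperp.
have : exists s, forall z, D z -> rdot (sig s u) z = 0.
  have /pfcard_geP[D0|[f]] := cD.
    by exists 1%g => z; rewrite D0.
  have /ae_foralln[N [mN N0 hN]] := fun n => aeu (f n).
  have [s Ns] : exists s, ~ N s.
    apply: contrapT => /forallNP allN; have [mu0 _ _] := hmu; apply: mu0.
    rewrite -N0; congr (mu _); apply/seteqP; split=> // s _.
    exact: contrapT (allN s).
  exists s => z Dz; have [n _ <-] := @surj _ _ _ _ f _ Dz.
  by have := contra_not (hN s) Ns; move=> /contrapT; apply.
move=> [s hs]; apply: rnorm_eq0; rewrite -(sig_rnorm s).
set y := sig s u in hs *.
apply/eqP; rewrite eq_le rnorm_ge0 andbT; apply/ler_addgt0Pl => e e0.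
have [z [/= yz Dz]] : exists z, rnorm (y - z) < e /\ D z.
  have yi : (interior [set z | rnorm (y - z) < e]) !=set0.
    by exists y; apply/nbhs_rnormP; exists e.
  have [z [yz Dz]] := dD _ yi (@open_interior _ _).
  by exists z; split => //; exact: interior_subset yz.
(* |y|^2 = <y, y - z> since z is orthogonal to y. *)
have : rnorm y ^+ 2 <= rnorm y * rnorm (y - z).
  by rewrite -rdotxx -[X in X <= _]subr0 -(hs z Dz) -rdotBr rdot_le.
have := rnorm_ge0 y; rewrite le_eqVlt => /predU1P[<- _|y0].
  by rewrite addr0 ltW.
rewrite expr2 ler_pM2l// addr0 => h; exact: le_trans h (ltW yz).
Qed.

(** w = P U x - U P x is a continuous vector, whereas <w, w> = <U (x - P x), w> vanishes because U
    preserves the orthogonal complement. *)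
Lemma continuous_projection_commute U :
  (forall x y, U (x + y) = U x + U y) ->
  (forall x, Hc x -> Hc (U x)) ->
  (forall x, (forall y, Hc y -> rdot x y = 0) ->
     forall y, Hc y -> rdot (U x) y = 0) ->
  forall P : H -> H, (forall x, Hc (P x)) ->
    (forall x y, Hc y -> rdot (P x) y = rdot x y) ->
  forall x, P (U x) = U (P x).
Proof.
move=> UD Uc Uperp P Pc hP x.
apply/eqP; rewrite -subr_eq0; apply/eqP/rdotxx_eq0.
have wc : Hc (P (U x) - U (P x)).
  apply: continuous_vectorsD => //; rewrite -scaleN1r.
  by apply: continuous_vectorsZ; exact: Uc.
set w := _ - _ in wc *; rewrite {1}/w rdotBl hP// -rdotBl.
have -> : U x - U (P x) = U (x - P x).
  by apply/eqP; rewrite subr_eq -UD subrK.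
by apply: Uperp => // y yc; rewrite rdotBl hP// subrr.
Qed.

(* The projection onto the continuous vectors is central, since both sig and its
   commutant preserve them; square integrability prevents it from being 0. *)
Lemma continuous_vectors_factor : is_factor (vN_generated sig) ->
  square_integrable mu sig -> forall x, Hc x.
Proof.
move=> sig_factor [xi [eta [_ coef_neq0]]].
have /choice[P hP] x : exists p, Hc p /\ forall y, Hc y -> rdot p y = rdot x y.
  by have [p] := continuous_projection x; exists p.
have Pc x : Hc (P x) by have [] := hP x.
have {}hP x y : Hc y -> rdot (P x) y = rdot x y by move=> yc; have [_ ->] := hP x.
have HcB x y : Hc x -> Hc y -> Hc (x - y).
  move=> xc yc; apply: continuous_vectorsD => //.
  by rewrite -scaleN1r; exact: continuous_vectorsZ.
have Puniq x p : Hc p -> (forall y, Hc y -> rdot p y = rdot x y) -> P x = p.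
  move=> pc hp; apply/eqP; rewrite -subr_eq0; apply/eqP/rdotxx_eq0.
  by rewrite rdotBl hP ?hp ?subrr//; exact: HcB.
have PlinZ (c : cplx R) x y : rdot (c *: x) y = rdot x (c^* *: y).
  rewrite /rdot linearZl_LR [X in _ = complex.Re X]linearZr_LR /=.
  by rewrite conjCK.
have Plin : linear P.
  move=> c x y; apply: Puniq.
    by apply: continuous_vectorsD => //; exact: continuous_vectorsZ.
  move=> z zc; rewrite !rdotDl !PlinZ !hP//.
  exact: continuous_vectorsZ.
have Pbd : bounded_operator P.
  apply: (@bound_bounded_operator _ _ _ 1) => // x; rewrite mul1r.
  have : rnorm (P x) ^+ 2 <= rnorm x * rnorm (P x).
    by rewrite -rdotxx hP// rdot_le.
  have := rnorm_ge0 (P x); rewrite le_eqVlt => /predU1P[<- _|P0].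
    exact: rnorm_ge0.
  by rewrite expr2 ler_pM2r.
have Psig s x : P (sig s x) = sig s (P x).
  apply: (continuous_projection_commute (sigD s) _ _ Pc hP).
    by move=> y; exact: continuous_vectors_sig.
  by move=> z zperp y yc; rewrite sigV zperp//; exact: continuous_vectors_sig.
have PS' : commutant (range sig) P.
  split => // _ [s _ <-]; apply/funext => x /=; exact: Psig.
(* U in the commutant maps sig t y - y to sig t (U y) - U y, so by boundedness it preserves the
   continuous vectors. *)
have PM : vN_generated sig P.
  split => // U [Ubd US]; apply/funext => x /=.
  have Usig s y : U (sig s y) = sig s (U y).
    by have /(congr1 (fun f => f y)) := US (sig s) ltac:(by exists s).
  have [lU _] := Ubd; have [C C0 hC] := bounded_operator_bound Ubd.
  have UD y z : U (y + z) = U y + U z by have := lU 1 y z; rewrite !scale1r.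
  have U0 : U 0 = 0 by have := UD 0 0; rewrite addr0 -[LHS]addr0 => /addrI.
  have UZ c y : U (c *: y) = c *: U y by have := lU c y 0; rewrite U0 !addr0.
  have UB y z : U (y - z) = U y - U z.
    by rewrite UD -[- z]scaleN1r UZ scaleN1r.
  apply: (continuous_projection_commute UD _ _ Pc hP).
    move=> y yc e e0; have C1 : 0 < C + 1 by rewrite ltr_wpDl.
    apply: filterS (yc _ (divr_gt0 e0 C1)) => t.
    rewrite -Usig -UB ltr_pdivlMr// => h; apply: (le_lt_trans (hC _)).
    by apply: le_lt_trans h; rewrite mulrC ler_wpM2l ?rnorm_ge0// lerDl.
  move=> z zperp y yc.
  (* U preserves the orthogonal complement once its adjoint preserves the continuous vectors. The
     adjoint comes from Riesz; for v the adjoint applied to y and w = sig t v - v, |w|^2 = <U w, sig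
     t y - y>. *)
  have adj w : exists v, forall x', rdot v x' = rdot (U x') w.
    have [v _ hv] : exists2 v : H, [set: H] v & forall x', [set: H] x' ->
        rdot v x' = rdot (U x') w.
      apply: (riesz_subspace (M := C * rnorm w)) => //.
      - by move=> x1 x2; rewrite UD rdotDl.
      - by move=> a x1; rewrite UZ rdotZl.
      - move=> x1; rewrite (le_trans (normr_rdot _ _))// mulrAC.
        by rewrite ler_wpM2r ?rnorm_ge0.
    by exists v => x'; exact: hv.
  have [v hv] := adj y.
  suff vc : Hc v by rewrite -hv rdotC zperp.
  move=> e e0; have C1 : 0 < C + 1 by rewrite ltr_wpDl.
  apply: filterS (yc _ (divr_gt0 e0 C1)) => t; rewrite ltr_pdivlMr// => h.
  set w := sig t v - v.
  have : rnorm w ^+ 2 <= rnorm w * (rnorm (sig t y - y) * C).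
    rewrite -rdotxx {1}/w rdotBl sigV !hv Usig sigV invgK -rdotBr.
    rewrite (le_trans (rdot_le _ _))// (mulrC _ C) mulrA (mulrC _ C).
    by rewrite ler_wpM2r ?rnorm_ge0.
  have := rnorm_ge0 w; rewrite le_eqVlt => /predU1P[<- //|w0].
  rewrite expr2 ler_pM2l// => h'; apply: (le_lt_trans h').
  by apply: le_lt_trans h; rewrite ler_wpM2l ?rnorm_ge0// lerDl.
have PM' : commutant (vN_generated sig) P.
  split => // U [_ US'']; apply/funext => x /=.
  by have /(congr1 (fun f => f x)) := US'' _ PS'.
have [c Pc'] : [set T | exists c : cplx R, T = fun x => c *: x] P.
  by rewrite -sig_factor.
(* P is now the scalar c: a nonzero continuous vector gives c = 1; without one, every vector is
   orthogonal to the continuous ones and all coefficients vanish almost everywhere. *)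
have [[x [xc x0]]|noc] := pselect (exists x, Hc x /\ x <> 0).
  have Px : P x = x by exact: Puniq.
  suff c1 : c = 1 by move=> y; have := Pc y; rewrite Pc' c1 scale1r.
  move: Px; rewrite Pc' -[RHS]scale1r => /eqP; rewrite -subr_eq0 -scalerBl.
  by rewrite scaler_eq0 subr_eq0 => /orP[/eqP//|/eqP].
have perp x y : Hc y -> rdot x y = 0.
  move=> yc; have [->|/eqP y0] := eqVneq y 0; first by rewrite rdot0r.
  by exfalso; apply: noc; exists y.
exfalso; apply: coef_neq0.
have ae1 := orthogonal_coefficient_ae (perp xi) eta.
(* i xi supplies the imaginary part of the coefficient. *)
have ae2 := orthogonal_coefficient_ae (perp ('i *: xi)) eta.
apply: (@filterS2 _ _ (ae_filter_ringOfSetsType mu) _ _ _ _ ae1 ae2).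
move=> s h1 h2; apply/eqP.
by rewrite eq_complex Im_hdot -sigZ h2 oppr0 eqxx andbT -[complex.Re _]/(rdot _ _) h1.
Qed.

End WeaklyMeasurable.

(** * The representation of the extension *)

Lemma linear_scale (R : realType) (H : hilbert R) (T : H -> H) (c : cplx R) x :
  linear T -> T (c *: x) = c *: T x.
Proof.
move=> lT; pose L : {linear H -> H} :=
  HB.pack T (GRing.isLinear.Build _ _ _ _ T lT).
exact: (linearZ_LR L).
Qed.

Section TwistedRepresentation.
Variables (R : realType) (G : preTopGroupType) (omega : borel_cocycle R G).
Variable tau : topology_on (circle R * G).
Local Notation E := (twisted omega tau).
Local Notation rep := (rep_twisted omega tau).

Lemma conj_circle (a : circle R) :
  (circle_val a)^* * circle_val a = 1 :> cplx R.
Proof. by rewrite mulrC -normCK (eqP (svalP a)) expr1n. Qed.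

Lemma unitary_scale (H : hilbert R) (T : H -> H) (a : circle R) :
  unitary T -> unitary (fun x => circle_val a *: T x).
Proof.
move=> [lT iT sT]; split.
- by move=> c x y; rewrite lT scalerDr !scalerA mulrC.
- move=> x y; rewrite linearZl_LR [X in _ * X]linearZr_LR /= mulrA iT.
  by rewrite -normCK (eqP (svalP a)) expr1n mul1r.
- move=> y; have [x Tx] := sT ((circle_val a)^-1 *: y).
  by exists x; rewrite Tx scalerA mulfV ?scale1r// circle_val_neq0.
Qed.

Lemma rep_twisted_one (H : hilbert R) (pi : G -> H -> H) s :
  rep pi ((1%g, s) : E) = pi s.
Proof. by apply/funext => x; rewrite /rep_twisted scale1r. Qed.

Lemma rep_twistedM (H : hilbert R) (pi : G -> H -> H) (x y : E) :
  projective_rep omega pi -> rep pi x \o rep pi y = rep pi (x * y)%g.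
Proof.
move=> [upi mpi _]; apply/funext => z; rewrite /= /rep_twisted.
have [lpi _ _] := upi x.2.
have := congr1 (fun f => f z) (mpi x.2 y.2) => /= e.
by rewrite linear_scale// e !scalerA -!circle_valM.
Qed.

Lemma vN_generated_twisted (H : hilbert R) (pi : G -> H -> H) :
  vN_generated (rep pi) = vN_generated pi.
Proof.
rewrite /vN_generated; congr commutant; apply/seteqP; split=> T [bT cT].
  split => // _ [s _ <-]; apply: cT.
  by exists ((1%g, s) : E) => //; exact: rep_twisted_one.
split => // _ [x _ <-]; apply/funext => z; rewrite /= /rep_twisted.
have [lT _] := bT.
have /= e := congr1 (fun f => f z) (cT _ (ex_intro2 _ _ x.2 Logic.I erefl)).
by rewrite -e linear_scale.
Qed.

(** [adjoint] is a choice by [xget]; uniqueness of adjoints identifies it with the candidate at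
    hand. *)
Lemma adjointE (H : hilbert R) (T S : H -> H) : is_adjoint T S -> adjoint T = S.
Proof.
move=> TS; apply: xget_unique => // S' TS'; apply/funext => y.
by apply: rdot_nondeg => z; rewrite rdotC [RHS]rdotC /rdot -TS -TS'.
Qed.

(** Surjectivity provides a right inverse S of T, and <T x, y> = <T x, T (S y)> = <x, S y>. *)
Lemma unitary_adjoint (H : hilbert R) (T : H -> H) :
  unitary T -> is_adjoint T (adjoint T).
Proof.
move=> [_ iT sT]; have [S hS] := choice sT.
suff TS : is_adjoint T S by rewrite (adjointE TS).
by move=> x y; rewrite -[in LHS](hS y) iT.
Qed.

Lemma adjoint_scale (H : hilbert R) (T : H -> H) (a : circle R) : unitary T ->
  adjoint (fun x => circle_val a *: T x) =
  (fun x => adjoint T ((circle_val a)^* *: x)).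
Proof.
move=> uT; apply: adjointE => x y; rewrite -(unitary_adjoint uT).
by rewrite linearZl_LR [RHS]linearZr_LR /= conjCK.
Qed.

(** The phase of x and its conjugate, which comes from the adjoint, cancel. *)
Lemma conjugate_twisted (H : hilbert R) (pi : G -> H -> H) (T : H -> H) (x : E) :
  unitary (pi x.2) -> linear T ->
  rep pi x \o T \o adjoint (rep pi x) = pi x.2 \o T \o adjoint (pi x.2).
Proof.
move=> upi lT; rewrite /rep_twisted adjoint_scale//; apply/funext => z /=.
have [lpi ipi spi] := upi.
(* [adjoint] is defined by choice; its homogeneity is derived here from its being the inverse of the
   linear bijection [pi x.2]. *)
have adjZ c y : adjoint (pi x.2) (c *: y) = c *: adjoint (pi x.2) y.
  have [w <-] := spi y.
  have adjK v : adjoint (pi x.2) (pi x.2 v) = v.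
    apply: rdot_nondeg => u; rewrite rdotC /rdot -(unitary_adjoint upi) ipi.
    by rewrite -[LHS]/(rdot _ _) rdotC.
  by rewrite -linear_scale// !adjK.
rewrite adjZ linear_scale// linear_scale// scalerA mulrC conj_circle.
by rewrite scale1r.
Qed.

(** [quasi_equivalent] expresses linearity through c T + U; the zero operator as U isolates
    homogeneity. *)
Lemma vN_generated0 (H : hilbert R) (I : Type) (pi : I -> H -> H) :
  vN_generated pi (fun=> 0).
Proof.
split.
  apply: (@bound_bounded_operator _ _ _ 0) => [c x y|x].
    by rewrite scaler0 addr0.
  by rewrite rnorm0 mul0r.
move=> U [[lU _] _]; apply/funext => x /=.
by rewrite -[in RHS](scale0r x) linear_scale// scale0r.
Qed.

Lemma vN_generated_gen (H : hilbert R) (I : Type) (pi : I -> H -> H) i :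
  bounded_operator (pi i) -> vN_generated pi (pi i).
Proof. by move=> bpi; split => // U [_ US]; rewrite US//; exists i. Qed.

Lemma unitary_bounded (H : hilbert R) (T : H -> H) :
  unitary T -> bounded_operator T.
Proof.
move=> uT; apply: (@bound_bounded_operator _ _ _ 1); first exact: unitary_linear.
by move=> x; rewrite mul1r unitary_rnorm.
Qed.

(** The algebras coincide, so the same [Phi] serves on both sides; homogeneity carries its value
    from pi(s) to a pi(s). *)
Lemma quasi_equivalent_twisted (H K : hilbert R) (pi : G -> H -> H)
    (rho : G -> K -> K) : projective_rep omega pi ->
  quasi_equivalent pi rho <-> quasi_equivalent (rep pi) (rep rho).
Proof.
move=> [upi _ _]; rewrite /quasi_equivalent !vN_generated_twisted.
split=> -[Phi [bij lin mul adj gen]]; exists Phi; split => //; last first.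
  by move=> s; rewrite -(rep_twisted_one pi) gen rep_twisted_one.
move=> x.
have M0 := vN_generated0 pi.
have Phi0 : Phi (fun=> 0) = (fun=> 0).
  have := lin 1 _ _ M0 M0; rewrite (_ : (fun x => _) = (fun=> 0)); last first.
    by apply/funext => y; rewrite scale1r addr0.
  move=> e; apply/funext => y; have := congr1 (fun f => f y) e => /=.
  by rewrite scale1r -[LHS]addr0 => /addrI.
have Mpi : vN_generated pi (pi x.2).
  exact/vN_generated_gen/unitary_bounded.
have := lin (circle_val x.1) _ _ Mpi M0; rewrite Phi0 gen => e.
rewrite /rep_twisted; transitivity (Phi (fun z => circle_val x.1 *: pi x.2 z + 0)).
  by congr Phi; apply/funext => z; rewrite addr0.
by rewrite e; apply/funext => z; rewrite addr0.
Qed.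

Lemma projective_rep_twisted (H : hilbert R) (pi : G -> H -> H) :
  twisted_topology omega tau -> projective_rep omega pi ->
  projective_rep (fun _ _ => 1%g) (rep pi).
Proof.
move=> htau hpi; have [upi _ mpi] := hpi; split.
- by move=> x; exact: unitary_scale.
- move=> x y; rewrite rep_twistedM//; apply/funext => z.
  by rewrite scale1r.
- by move=> xi eta; exact: measurable_rep_twisted.
Qed.

End TwistedRepresentation.

Lemma unitary_rep_twisted (R : realType) (G : preTopGroupType)
    (omega : borel_cocycle R G) (tau : topology_on (circle R * G))
    (htau : twisted_topology omega tau)
    (muE : {measure set (borelType (twisted omega tau)) -> \bar R})
    (hmuE : left_haar muE) (H : hilbert R) (pi : G -> H -> H)
    (hpi : projective_rep omega pi) :
  hseparable H \/ factorial_square_integrable muE (rep_twisted omega tau pi) ->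
  unitary_rep (rep_twisted omega tau pi).
Proof.
have lcE : lcsc_group (twisted omega tau) by have [] := htau.
have [urep _ mrep] := projective_rep_twisted htau hpi.
have repM x y z : rep_twisted omega tau pi x (rep_twisted omega tau pi y z) =
    rep_twisted omega tau pi (x * y)%g z.
  by rewrite -(rep_twistedM (tau := tau) x y hpi).
move=> h; split => //; first by move=> x y; exact: rep_twistedM.
move=> xi; apply: (continuous_vectorsP lcE urep repM).
case: h => [sepH|[fac sq]].
  exact: (continuous_vectors_separable lcE hmuE urep repM mrep sepH).
exact: (continuous_vectors_factor lcE hmuE urep repM mrep fac sq).
Qed.

Theorem proposition3p5 (R : realType) (G : preTopGroupType)
  (hG : lcsc_group G)
  (muG : {measure set (borelType G) -> \bar R}) (hmuG : left_haar muG)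
  (DeltaG : G -> R) (hDeltaG : modular_function muG DeltaG)
  (omega : borel_cocycle R G)
  (tau : topology_on (circle R * G)) (htau : twisted_topology omega tau)
  (muE : {measure set (borelType (twisted omega tau)) -> \bar R})
  (hmuE : left_haar muE)
  (DeltaE : twisted omega tau -> R) (hDeltaE : modular_function muE DeltaE)
  (H : hilbert R) (pi : G -> H -> H) (hpi : projective_rep omega pi) :
  [/\ (* pi_omega is a representation *)
      projective_rep (fun _ _ => 1%g) (rep_twisted omega tau pi) /\
      (hseparable H -> unitary_rep (rep_twisted omega tau pi)),
      (* (a) *)
      (projective_rep omega pi /\ factorial_square_integrable muG pi <->
       unitary_rep (rep_twisted omega tau pi) /\
       factorial_square_integrable muE (rep_twisted omega tau pi)) /\
      (factorial_square_integrable muG pi ->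
       forall psi : (H -> H) -> \bar R,
         semi_invariant_weight pi DeltaG psi ->
         semi_invariant_weight (rep_twisted omega tau pi) DeltaE psi) &
      (* (b) *)
      forall (K : hilbert R) (rho : G -> K -> K),
        projective_rep omega rho ->
        (quasi_equivalent pi rho <->
         quasi_equivalent (rep_twisted omega tau pi)
                          (rep_twisted omega tau rho))].
Proof.
have hrep := projective_rep_twisted htau hpi.
have [upi mulpi mpi] := hpi.
have sqE := square_integrable_twisted hG hmuG hDeltaG htau hmuE mpi.
have fsiE : factorial_square_integrable muE (rep_twisted omega tau pi) <->
    factorial_square_integrable muG pi.
  by rewrite /factorial_square_integrable vN_generated_twisted sqE.
split.
- split => // sepH.
  by apply: (unitary_rep_twisted htau hmuE hpi); left.
- split.
    split=> [[_ /fsiE fsi]|[_ /fsiE fsi]]; split => //.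
    (* Strong continuity comes here from factoriality and square integrability. *)
    by apply: (unitary_rep_twisted htau hmuE hpi); right.
  move=> _ psi [w nz nw sf si].
  split; rewrite ?vN_generated_twisted// => x T MT.
  rewrite conjugate_twisted//; last by have [[[lT _] _] _] := MT.
  by rewrite si// (modular_twisted hG hmuG hDeltaG htau hmuE hDeltaE).
- by move=> K rho _; exact: quasi_equivalent_twisted.
Qed.
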